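(* Let $X$ be a Wiener--Weierstra\ss\ bridge with $H=1/2$ (so $W$ is a standard Brownian motion and $\kappa$ is H\''older continuous with some exponent $\tau>1/2$), and parameters $\alpha\in(0,1)$, $b\in\{2,3,\dots\}$ with $\alpha^2b=1$. Then $\mathbb P$-a.s., for all $t\in(0,1]$, $$\lim_{n\to\infty}\frac1n\sum_{k=0}^{\lfloor tb^n\rfloor-1}\big(X((k+1)b^{-n})-X(kb^{-n})\big)^2=t .$$ In particular, $\mathbb P$-a.s. the $p$-th variation $\langle X\rangle^{(p)}_1$ is infinite for every $p\le2$ and zero for every $p>2$.
   Context: Let $W=(W(t))_{t\ge0}$ be a fractional Brownian motion with Hurst parameter $H\in(0,1)$. Let $\kappa:[0,1]\to[0,1]$ be a deterministic function with $\kappa(0)=0$, $\kappa(1)=1$ that is H\''older continuous with some exponent $\tau\in(H,1]$. The fractional Brownian bridge is $B(t):=W(t)-\kappa(t)W(1)$, $t\in[0,1]$. For $x\ge0$, $\{x\}$ denotes the fractional part of $x$. For $\alpha\in(0,1)$, $b\in\{2,3,\dots\}$, the fractional Wiener--Weierstra\ss\ bridge is $X(t):=\sum_{n=0}^\infty\alpha^nB(\{b^nt\})$, $0\le t\le1$. For a function $f:[0,1]\to\mathbb R$ and $p>0$, the $p$-th variation along the $b$-adic partitions is $\langle f\rangle^{(p)}_t:=\lim_{n\to\infty}\sum_{k=0}^{\lfloor tb^n\rfloor-1}|f((k+1)b^{-n})-f(kb^{-n})|^p$, $t\in[0,1]$, provided the limit exists (possibly $+\infty$). *)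

(* Defs.v *)
From HB Require Import structures.
From mathcomp Require Import all_boot all_order all_algebra.
From mathcomp Require Import all_classical all_reals all_analysis.
Set Implicit Arguments. Unset Strict Implicit. Unset Printing Implicit Defensive.
Import Order.TTheory GRing.Theory Num.Theory.
Import numFieldNormedType.Exports.
Local Open Scope classical_set_scope.
Local Open Scope ring_scope.

Section Defs.
Context {R : realType}.

Definition centered_gaussian_law (v : R) : set R -> \bar R :=
  if v == 0 then \d_(0 : R) else normal_prob 0 (Num.sqrt v).

Definition is_centered_gaussian {d} {T : measurableType d} (P : probability T R)
  (Y : T -> R) (v : R) : Prop :=
  measurable_fun setT Y /\
  forall A : set R, measurable A -> P (Y @^-1` A) = centered_gaussian_law v A.

(** Standard Brownian motion (H = 1/2 fractional Brownian motion) on [0,oo):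
    a centered Gaussian process with covariance min(s,t) (all finite linear
    combinations are centered Gaussian with the corresponding variance)
    and almost surely continuous paths on [0, oo). *)
Definition standard_brownian_motion {d} {T : measurableType d}
  (P : probability T R) (W : R -> T -> R) : Prop :=
  (forall (n : nat) (ts : 'I_n -> R) (c : 'I_n -> R),
      (forall i, 0 <= ts i) ->
      is_centered_gaussian P (fun w => \sum_(i < n) c i * W (ts i) w)
        (\sum_(i < n) \sum_(j < n) c i * c j * Num.min (ts i) (ts j)))
  /\ {ae P, forall w, {within [set t : R | 0 <= t], continuous (fun t => W t w)}}.

Definition holder_on_01 (f : R -> R) (tau : R) : Prop :=
  exists C : R, forall s t : R, 0 <= s <= 1 -> 0 <= t <= 1 ->
    `|f s - f t| <= C * (`|s - t| `^ tau).

Definition frac (x : R) : R := x - (Num.floor x)%:~R.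

Definition bridge (W : R -> R) (kappa : R -> R) (t : R) : R :=
  W t - kappa t * W 1.

Definition ww_bridge (W : R -> R) (kappa : R -> R) (alpha : R) (b : nat)
  (t : R) : R :=
  limn (fun N : nat =>
    \sum_(0 <= n < N) alpha ^+ n * bridge W kappa (frac ((b%:R) ^+ n * t))).

Definition badic_pvar_sum (f : R -> R) (b : nat) (p t : R) (n : nat) : R :=
  \sum_(0 <= k < Num.truncn (t * (b%:R) ^+ n))
    `|f (k.+1%:R / (b%:R) ^+ n) - f (k%:R / (b%:R) ^+ n)| `^ p.

Definition badic_qv_sum (f : R -> R) (b : nat) (t : R) (n : nat) : R :=
  \sum_(0 <= k < Num.truncn (t * (b%:R) ^+ n))
    (f (k.+1%:R / (b%:R) ^+ n) - f (k%:R / (b%:R) ^+ n)) ^+ 2.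

Definition pvariation_is (f : R -> R) (b : nat) (p t : R) (v : \bar R) : Prop :=
  ((fun n => (badic_pvar_sum f b p t n)%:E) @ \oo --> v)%E.

End Defs.

(* Main.v *)
Require Import Defs.
From HB Require Import structures.
From mathcomp Require Import all_boot all_order all_algebra.
From mathcomp Require Import all_classical all_reals all_analysis.
From mathcomp Require Import measurable_realfun ring lra zify.
Set Implicit Arguments. Unset Strict Implicit. Unset Printing Implicit Defensive.
Import Order.TTheory GRing.Theory Num.Theory.
Import numFieldNormedType.Exports.
Local Open Scope classical_set_scope.
Local Open Scope ring_scope.

(** At a b-adic point the series defining [X] is a finite sum, so the increment
    of [X] over [[k/b^n, (k+1)/b^n]] is [alpha^n (S_(n,k) - W(1) D_(n,k))], where
    [S_(n,k)] is the sum over [1 <= r <= n] of [alpha^-r] times the increment of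
    [W] over the level-[r] interval whose left end is the fractional part of
    [k/b^r], and [D_(n,k)] is the same sum for [kappa], bounded because [kappa]
    is Hoelder of order larger than [1/2]. As [alpha^2 b = 1], each of the [n]
    terms of [S_(n,k)] has variance 1; terms of different levels are correlated
    only when the intervals are nested, i.e. when base-b digits of the indices
    agree, which is rare. Digit counting gives [sum_k Var S_(n,k) = n K + O(b^n)]
    over [k < K], and [sum_(k,l) Cov(S_(n,k), S_(n,l))^2 = O(b^(2n))]. By
    Gaussianity the latter is half the variance of [sum_k S_(n,k)^2], so the
    normalized quadratic variation has variance [O(1/n^2)]; this is summable, hence
    there is almost sure convergence for each [t], and for all [t] by monotonicity.
    Fourth moments bound the largest increment by a geometric sequence,
    which reduces the [p]-th variation to the quadratic one. *)

(** * Moments of the normal law *)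

Lemma ge0_integral_density (d : measure_display) (T : measurableType d)
  (R : realType) (nu : {finite_measure set T -> \bar R})
  (mu : {sigma_finite_measure set T -> \bar R}) (g f : T -> \bar R) :
  nu `<< mu -> measurable_fun setT g ->
  (forall A, measurable A -> nu A = (\int[mu]_(x in A) g x)%E) ->
  (forall x, (0 <= f x)%E) -> measurable_fun setT f ->
  (\int[nu]_x f x = \int[mu]_x (f x * g x))%E.
Proof.
move=> numu mg nug f0 mf.
rewrite -(Radon_Nikodym_SigmaFinite.change_of_variables numu f0)//.
have int_f := Radon_Nikodym_SigmaFinite.f_integrable numu.
apply: ae_eq_integral => //.
- apply: emeasurable_funM => //; exact: measurable_int int_f.
- exact: emeasurable_funM.
- apply: ae_eqe_mul2l => /=.
  apply: integral_ae_eq => //= A _ mA.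
  by rewrite -Radon_Nikodym_SigmaFinite.f_integral// nug.
Qed.

Lemma is_derive_exprn {R : realType} n (x : R) :
  is_derive x 1 (fun y : R => y ^+ n) (n%:R * x ^+ n.-1).
Proof.
have -> : (fun y : R => y ^+ n) = id ^+ n by rewrite exprfctE.
by apply: is_derive_eq; rewrite /GRing.scale/= mulr1.
Qed.

Section normal_moments.
Context {R : realType} (s : R).
Hypothesis s_gt0 : 0 < s.
Let phi : R -> R := normal_pdf 0 s.
Let mu := @lebesgue_measure R.

Let s_neq0 : s != 0. Proof. by rewrite gt_eqF. Qed.

Lemma is_derive_normal_pdf (x : R) : is_derive x 1 phi (- x / s ^+ 2 * phi x).
Proof.
rewrite /phi normal_pdfE//.
have -> : (fun x => normal_peak s * normal_fun 0 s x) =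
   (fun x => normal_peak s *: (expR \o (fun x => - (s ^+ 2 *+ 2)^-1 *: x ^+ 2)) x).
  by apply/funext => y; rewrite /normal_fun subr0 /GRing.scale/= !mulNr [X in - X]mulrC.
have h : is_derive x 1 (fun x : R => - (s ^+ 2 *+ 2)^-1 *: x ^+ 2)
    (- (s ^+ 2 *+ 2)^-1 *: (2%:R * x ^+ 1)).
  by apply: is_deriveZ; exact: is_derive_exprn.
have h2 := is_derive1_comp (is_derive_expR _) h.
apply: (is_derive_eq (is_deriveZ (normal_peak s) h2)).
rewrite /GRing.scale/=.
have -> : normal_fun 0 s x = expR (- (s ^+ 2 *+ 2)^-1 * x ^+ 2).
  by rewrite /normal_fun subr0 !mulNr [X in - X]mulrC.
by set E := expR _; field.
Qed.

Lemma continuous_pow_normal_pdf j : continuous (fun x : R => x ^+ j * phi x).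
Proof.
move=> x; apply: cvgM; first exact: exprn_continuous.
exact: continuous_normal_pdf.
Qed.

Lemma cvg_pow_normal_pdf j : (j <= 3)%N ->
  (fun n : nat => n%:R ^+ j * phi n%:R) @ \oo --> (0 : R).
Proof.
move=> j3.
pose C := normal_peak s * (2 * (s ^+ 2 *+ 2) ^+ 2).
have ph n : 0 <= n.+1%:R ^+ j * phi n.+1%:R <= C * harmonic n.
  apply/andP; split; first by rewrite mulr_ge0// normal_pdf_ge0.
  rewrite /phi normal_pdfE// /normal_fun subr0 mulNr expRN.
  set y := n.+1%:R ^+ 2 / _.
  have y0 : 0 < y by rewrite mulr_gt0 ?invr_gt0 ?pmulrn_lgt0 ?exprn_gt0.
  have hy : (expR y)^-1 <= 2 / y ^+ 2.
    rewrite -[leRHS]invrK lef_pV2 ?posrE ?expR_gt0 ?invr_gt0 ?divr_gt0 ?exprn_gt0//.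
    rewrite invf_div; apply: le_trans (expR_ge1Dxn 1 (ltW y0)).
    by rewrite (_ : 2`!%:R = 2)// lerDr.
  rewrite mulrCA /C -mulrA ler_pM2l ?normal_peak_gt0//.
  apply: (@le_trans _ _ (n.+1%:R ^+ 3 * (2 / y ^+ 2))).
    apply: ler_pM => //; rewrite ?exprn_ge0 ?invr_ge0 ?expR_ge0//.
    by apply: ler_weXn2l => //; rewrite ler1n.
  rewrite /y le_eqVlt; apply/orP; left; apply/eqP; rewrite /harmonic/=.
  have n0 : n.+1%:R != 0 :> R by rewrite pnatr_eq0.
  by move: (n.+1%:R : R) n0 => m m0; field; exact/andP.
suff : [sequence n.+1%:R ^+ j * phi n.+1%:R]_n @ \oo --> (0 : R).
  by rewrite (@cvg_shiftS R (fun n : nat => n%:R ^+ j * phi n%:R)).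
apply: (@squeeze_cvgr _ _ _ _ (fun=> 0) (fun n => C * harmonic n)).
- by apply: nearW => n; exact: ph.
- exact: cvg_cst.
- rewrite -(mulr0 C); apply: cvgM; first exact: cvg_cst.
  exact: cvg_harmonic.
Qed.

Let half j := (\int[mu]_(x in `[0%R, +oo[) (x ^+ j * phi x)%:E)%E.

Lemma half_moment_rec j : ~~ odd j -> (j <= 2)%N ->
  half j.+2 = ((j.+1%:R * s ^+ 2)%:E * half j)%E.
Proof.
move=> oj j2.
have cvgh i : ~~ odd i ->
    (\int[mu]_(x in `[0%R, n%:R]) (x ^+ i * phi x)%:E)%E @[n --> \oo] --> half i.
  move=> oi; apply: ge0_cvgn_integral.
    by move=> x; rewrite mulr_ge0 ?normal_pdf_ge0// exprn_even_ge0//.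
  by apply: continuous_measurable_fun; exact: continuous_pow_normal_pdf.
apply: (cvg_unique _ (cvgh j.+2 _)) => //=; first by rewrite negbK.
rewrite -[X in _ --> X]add0e.
have : (fun n : nat => (- s ^+ 2 * (n%:R ^+ j.+1 * phi n%:R))%:E +
   (j.+1%:R * s ^+ 2)%:E * \int[mu]_(x in `[0%R, n%:R]) (x ^+ j * phi x)%:E)%E @ \oo -->
   (0%:E + (j.+1%:R * s ^+ 2)%:E * half j)%E.
  apply: cvgeD => //.
    by apply/cvg_EFin; [exact: nearW|];
    rewrite -(mulr0 (- s ^+ 2)); apply: cvgM; [exact: cvg_cst|exact: cvg_pow_normal_pdf].
  by apply: cvgeZl => //; apply: cvgh.
apply: cvg_trans; apply: near_eq_cvg; near=> n.
have n0 : 0 < n%:R :> R by rewrite ltr0n; near: n; exists 1%N.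
have dp (x : R) : derivable phi x 1 by have [] := is_derive_normal_pdf x.
have cp x : {for x, continuous phi} by exact: continuous_normal_pdf.
have dX (x : R) := is_derive_exprn j.+1 x.
have dG (x : R) : is_derive x 1 (fun x => (- s ^+ 2) *: phi x) (x * phi x).
  apply: (is_derive_eq (is_deriveZ (- s ^+ 2) (is_derive_normal_pdf x))).
  by rewrite /GRing.scale/=; field.
have LR (F : R -> R) : (forall x, derivable F x 1) ->
    derivable_oo_LRcontinuous F 0 n%:R.
  move=> dF; have cF x : {for x, continuous F}.
    by apply: differentiable_continuous; apply/derivable1_diffP.
  split=> //; [apply: cvg_at_right_filter|apply: cvg_at_left_filter]; exact: cF.
have cX k : continuous (fun x : R => x ^+ k) by exact: exprn_continuous.
transitivity (\int[mu]_(x in `[0%R, n%:R]) (x ^+ j.+1 * (x * phi x))%:E)%E; last first.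
  by apply: eq_integral => x _; rewrite mulrA -exprSr.
have -> := @integration_by_parts R (fun x => x ^+ j.+1) (fun x => (- s ^+ 2) *: phi x)
   (fun x => j.+1%:R * x ^+ j) (fun x => x * phi x) 0 n%:R n0.
- rewrite expr0n/= mul0r subr0.
  congr (_ + _)%E; first by rewrite /GRing.scale/= mulrCA.
  rewrite -[LHS]oppeK -mulNe -EFinN -integralZl//; last first.
    apply: continuous_compact_integrable; first exact: segment_compact.
    by apply: continuous_subspaceT; exact: continuous_pow_normal_pdf.
  congr (- _)%E; apply: eq_integral => x _.
  by rewrite -EFinM; congr EFin; rewrite /GRing.scale/=; ring.
- by apply: continuous_subspaceT => x; apply: cvgM; [exact: cvg_cst|exact: cX].
- by apply: LR => x; have [] := dX x.
- by move=> x _; rewrite derive1E; have [_ ->] := dX x.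
- by apply: continuous_subspaceT => x; apply: cvgM; [exact: cvg_id|exact: cp].
- by apply: LR => x; have [] := dG x.
- by move=> x _; rewrite derive1E; have [_ ->] := dG x.
Unshelve. all: end_near. Qed.

Lemma normal_moment j : ~~ odd j ->
  (\int[mu]_x (x ^+ j * phi x)%:E = 2%:E * half j)%E.
Proof.
move=> oj; rewrite ge0_symfun_integralT//=.
- congr (_ * _)%E; rewrite /half; congr (integral _ _ _).
  by apply/seteqP; split => x/=; rewrite in_itv/= andbT.
- by move=> x; rewrite mulr_ge0 ?normal_pdf_ge0// exprn_even_ge0.
- exact: continuous_pow_normal_pdf.
- move=> x/=; rewrite exprNn -signr_odd (negbTE oj) mul1r /phi !normal_pdfE//.
  by rewrite /normal_fun !subr0 sqrrN.
Qed.

Lemma normal_moment2 : (\int[mu]_x (x ^+ 2 * phi x)%:E = (s ^+ 2)%:E)%E.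
Proof.
rewrite normal_moment// half_moment_rec// muleCA -normal_moment// mul1r.
under eq_integral do rewrite expr0 mul1r.
by rewrite integral_normal_pdf mule1.
Qed.

Lemma normal_moment4 : (\int[mu]_x (x ^+ 4 * phi x)%:E = (3 * s ^+ 4)%:E)%E.
Proof.
rewrite normal_moment// half_moment_rec// muleCA -normal_moment// normal_moment2.
by rewrite -EFinM; congr EFin; ring.
Qed.

End normal_moments.

(** * Means and almost sure convergence *)

Section has_mean.
Context {d : measure_display} {T : measurableType d} {R : realType}.
Variable P : probability T R.
Implicit Types (f g : T -> R) (a b : R).

Definition has_mean f a : Prop :=
  P.-integrable setT (EFin \o f) /\ (\int[P]_x (f x)%:E = a%:E)%E.

Lemma eq_has_mean f g a b : f =1 g -> a = b -> has_mean f a -> has_mean g b.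
Proof. by move=> /funext -> ->. Qed.

Lemma has_meanD f g a b :
  has_mean f a -> has_mean g b -> has_mean (fun x => f x + g x) (a + b).
Proof.
move=> [fi fa] [gi gb]; split; first exact: (integrableD _ fi gi).
by under eq_integral do rewrite EFinD; rewrite integralD// fa gb.
Qed.

Lemma has_meanZ c f a : has_mean f a -> has_mean (fun x => c * f x) (c * a).
Proof.
move=> [fi fa]; split; first exact: (integrableZl _ _ fi).
by under eq_integral do rewrite EFinM; rewrite integralZl// fa.
Qed.

Lemma has_mean_cst a : has_mean (fun=> a) a.
Proof.
split; last first.
  by rewrite integral_cst// -[RHS]mule1; congr (_ * _)%E; exact: probability_setT.
exact: finite_measure_integrable_cst measurableT.
Qed.

Lemma has_mean_sum (I : Type) (r : seq I) (F : I -> T -> R) (m : I -> R) :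
  (forall i, has_mean (F i) (m i)) ->
  has_mean (fun x => \sum_(i <- r) F i x) (\sum_(i <- r) m i).
Proof.
move=> Fm; elim: r => [|i r IH].
  by apply: (eq_has_mean _ _ (has_mean_cst 0)) => [x|]; rewrite big_nil.
by apply: (eq_has_mean _ _ (has_meanD (Fm i) IH)) => [x|]; rewrite big_cons.
Qed.

Lemma ge0_has_mean f a : (forall x, 0 <= f x) -> measurable_fun setT f ->
  (\int[P]_x (f x)%:E = a%:E)%E -> has_mean f a.
Proof.
move=> f0 mf fa; split=> //; apply/integrableP; split; first exact/measurable_EFinP.
by under eq_integral do rewrite /= ger0_norm//; rewrite fa ltry.
Qed.

Lemma ae_cvg0_of_summable_means (f : nat -> T -> R) (m : nat -> R) (C : R) :
  (forall n x, 0 <= f n x) -> (forall n, has_mean (f n) (m n)) ->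
  (forall N, \sum_(0 <= n < N) m n <= C) ->
  {ae P, forall x, (fun n => f n x) @ \oo --> (0 : R)}.
Proof.
move=> f0 fm mC.
have mf n : measurable_fun setT (EFin \o f n) by have [/integrableP[]] := fm n.
pose g x := (\sum_(0 <= n <oo) (f n x)%:E)%E.
have gint : (\int[P]_x g x <= C%:E)%E.
  rewrite integral_nneseries//; last by move=> n x _; rewrite lee_fin.
  apply: lime_le.
    by apply: is_cvg_nneseries => n _ _; apply: integral_ge0 => x _; rewrite lee_fin.
  apply: nearW => N; under eq_bigr do rewrite (fm _).2.
  by rewrite sumEFin lee_fin.
have g0 x : (0 <= g x)%E by apply: nneseries_ge0 => n _ _; rewrite lee_fin.
have gi : P.-integrable setT g.
  apply/integrableP; split.
    apply: (@ge0_emeasurable_sum _ _ _ setT (fun n x => (f n x)%:E) xpredT).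
      by move=> n x _ _; rewrite lee_fin.
    by move=> n _; exact: mf.
  by under eq_integral do rewrite gee0_abs//; exact: le_lt_trans gint (ltry _).
have := integrable_ae measurableT gi; apply: filterS => x /(_ I) gx.
apply: cvg_series_cvg_0; apply: nnseries_is_cvg => //.
by rewrite -ge0_fin_numE; [exact: gx|exact: g0].
Qed.

Lemma is_centered_gaussian_moments Y (v : R) : 0 <= v ->
  is_centered_gaussian P Y v ->
  has_mean (fun x => Y x ^+ 2) v /\ has_mean (fun x => Y x ^+ 4) (3 * v ^+ 2).
Proof.
move=> v0 [mY lawY].
pose Z : T -> measurableTypeR R := Y.
have mZ : measurable_fun setT Z by exact: mY.
have mX j : measurable_fun [set: measurableTypeR R] (fun x : R => x ^+ j).
  exact: exprn_measurable.
have evX (j : nat) (x : R) : ~~ odd j -> 0 <= x ^+ j by move=> oj; exact: exprn_even_ge0.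
have push j : ~~ odd j -> (\int[P]_x (Y x ^+ j)%:E =
    \int[pushforward P Z]_x (x ^+ j)%:E)%E.
  move=> oj; rewrite (ge0_integral_pushforward mZ) ?preimage_setT//.
  - exact/measurable_EFinP.
  - by move=> y _; rewrite lee_fin evX.
have mean j c : ~~ odd j -> (\int[pushforward P Z]_x (x ^+ j)%:E = c%:E)%E ->
    has_mean (fun x => Y x ^+ j) c.
  move=> oj jc; apply: ge0_has_mean.
  - by move=> x; exact: evX.
  - exact: (measurableT_comp (exprn_measurable j) mY).
  - by rewrite push.
move: v0; rewrite le_eqVlt => /orP[/eqP v0|v0].
  have law0 A : measurable A -> A `<=` setT ->
      pushforward P Z A = \d_((0 : R) : measurableTypeR R) A.
    by move=> mA _; rewrite /pushforward lawY// /centered_gaussian_law -v0 eqxx.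
  have dirac j : (\int[pushforward P Z]_x (x ^+ j.+1)%:E = 0%:E)%E.
    transitivity (\int[\d_((0%R : R) : measurableTypeR R)]_x (x ^+ j.+1)%:E)%E.
      exact: eq_measure_integral law0.
    rewrite integral_dirac//; first by rewrite diracT mul1e expr0n.
    exact/measurable_EFinP.
  by split; apply: mean; rewrite // -v0 ?expr0n ?mulr0 dirac.
pose s := Num.sqrt v; have s0 : 0 < s by rewrite sqrtr_gt0.
have sv : s ^+ 2 = v by rewrite sqr_sqrtr// ltW.
have law1 A : measurable A -> A `<=` setT -> pushforward P Z A = normal_prob 0 s A.
  by move=> mA _; rewrite /pushforward lawY// /centered_gaussian_law gt_eqF.
have dens j : ~~ odd j -> (\int[pushforward P Z]_x (x ^+ j)%:E =
    \int[lebesgue_measure]_x (x ^+ j * normal_pdf 0 s x)%:E)%E.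
  move=> oj; transitivity (\int[normal_prob 0%R s]_x (x ^+ j)%:E)%E.
    exact: eq_measure_integral law1.
  rewrite (@ge0_integral_density _ _ _ _ lebesgue_measure (EFin \o normal_pdf 0 s)).
  - by apply: eq_integral => x _; rewrite EFinM.
  - exact: normal_prob_dominates.
  - by apply/measurable_EFinP; exact: measurable_normal_pdf.
  - by [].
  - by move=> x; rewrite lee_fin evX.
  - exact/measurable_EFinP.
split; apply: mean => //; rewrite dens//.
  by rewrite normal_moment2// sv.
by rewrite normal_moment4// -sv; congr EFin; ring.
Qed.

End has_mean.

(** * Linear combinations of a Brownian motion *)

Section linear_combinations.
Context {R : realType}.
Implicit Types (s u v : seq (R * R)) (a : R).

(** A finite list of pairs (c, t) stands for the combination of the W(t) with
    coefficients c. *)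
Definition lincomb (f : R -> R) s : R := \sum_(x <- s) x.1 * f x.2.

Definition bm_cov s u : R :=
  \sum_(x <- s) \sum_(y <- u) x.1 * y.1 * Num.min x.2 y.2.

Definition scale_comb a s : seq (R * R) := [seq (a * x.1, x.2) | x <- s].

Definition nonneg_times s : bool := all (fun x => 0 <= x.2) s.

Lemma lincomb_cat f s u : lincomb f (s ++ u) = lincomb f s + lincomb f u.
Proof. exact: big_cat. Qed.

Lemma lincomb_scale f a s : lincomb f (scale_comb a s) = a * lincomb f s.
Proof.
by rewrite /lincomb big_map mulr_sumr; apply: eq_bigr => x _; rewrite mulrA.
Qed.

Lemma bm_covC s u : bm_cov s u = bm_cov u s.
Proof.
rewrite /bm_cov exchange_big/=; apply: eq_bigr => x _; apply: eq_bigr => y _.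
by rewrite minC [x.1 * _]mulrC.
Qed.

Lemma bm_cov_catl s u v : bm_cov (s ++ u) v = bm_cov s v + bm_cov u v.
Proof. exact: big_cat. Qed.

Lemma bm_cov_catr s u v : bm_cov v (s ++ u) = bm_cov v s + bm_cov v u.
Proof. by rewrite bm_covC bm_cov_catl !(bm_covC v). Qed.

Lemma bm_cov_scalel a s u : bm_cov (scale_comb a s) u = a * bm_cov s u.
Proof.
rewrite /bm_cov big_map mulr_sumr; apply: eq_bigr => x _.
by rewrite mulr_sumr; apply: eq_bigr => y _; rewrite !mulrA.
Qed.

Lemma bm_cov_scaler a s u : bm_cov u (scale_comb a s) = a * bm_cov u s.
Proof. by rewrite bm_covC bm_cov_scalel bm_covC. Qed.

End linear_combinations.

Section brownian_moments.
Context {d : measure_display} {T : measurableType d} {R : realType}.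
Variables (P : probability T R) (W : R -> T -> R).
Hypothesis BM : standard_brownian_motion P W.
Local Notation L s := (fun w => lincomb (W^~ w) s).
Implicit Types (s u : seq (R * R)).

Lemma lincomb_gaussian s : nonneg_times s ->
  is_centered_gaussian P (L s) (bm_cov s s).
Proof.
move=> /allP s0; pose t := in_tuple s.
have := BM.1 (size s) (fun i => (tnth t i).2) (fun i => (tnth t i).1)
  (fun i => s0 _ (mem_tnth i t)).
congr is_centered_gaussian.
  by apply/funext => w; rewrite /lincomb [RHS]big_tnth.
rewrite /bm_cov [RHS]big_tnth; apply: eq_bigr => i _.
by rewrite [RHS]big_tnth.
Qed.

Lemma lincomb_moments s : nonneg_times s -> 0 <= bm_cov s s ->
  has_mean P (fun w => L s w ^+ 2) (bm_cov s s) /\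
  has_mean P (fun w => L s w ^+ 4) (3 * bm_cov s s ^+ 2).
Proof. by move=> s0 c0; apply: is_centered_gaussian_moments (lincomb_gaussian s0). Qed.

(** The polarization only involves combinations with nonnegative coefficients,
    so that all the variances are visibly nonnegative. *)
Lemma lincomb_sqr_sqr s u : nonneg_times s -> nonneg_times u ->
  0 <= bm_cov s s -> 0 <= bm_cov u u -> 0 <= bm_cov s u ->
  has_mean P (fun w => L s w ^+ 2 * L u w ^+ 2)
    (bm_cov s s * bm_cov u u + 2 * bm_cov s u ^+ 2).
Proof.
move=> s0 u0 ss uu su.
have M (a b : R) : 0 <= a -> 0 <= b ->
    has_mean P (fun w => (a * L s w + b * L u w) ^+ 4)
      (3 * (a ^+ 2 * bm_cov s s + b ^+ 2 * bm_cov u u + 2 * a * b * bm_cov s u) ^+ 2).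
  move=> a0 b0; pose v := scale_comb a s ++ scale_comb b u.
  have vv : bm_cov v v =
      a ^+ 2 * bm_cov s s + b ^+ 2 * bm_cov u u + 2 * a * b * bm_cov s u.
    rewrite /v !(bm_cov_catl, bm_cov_catr, bm_cov_scalel, bm_cov_scaler).
    by rewrite (bm_covC u s); ring.
  have v0 : nonneg_times v.
    by rewrite /nonneg_times all_cat; apply/andP; rewrite !all_map.
  have [|_] := lincomb_moments v0.
    by rewrite vv !addr_ge0 ?mulr_ge0.
  apply: eq_has_mean => [w|]; last by rewrite vv.
  by rewrite lincomb_cat !lincomb_scale.
have M1 := has_meanZ (10 / 12) (M 1 1 ler01 ler01).
have M2 := has_meanZ (7 / 12) (M 1 0 ler01 (lexx _)).
have M3 := has_meanZ (7 / 12) (M 0 1 (lexx _) ler01).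
have M4 := has_meanZ (- 1 / 12) (M 1 2 ler01 (ler0n _ 2)).
have M5 := has_meanZ (- 1 / 12) (M 2 1 (ler0n _ 2) ler01).
apply: (eq_has_mean _ _ (has_meanD (has_meanD (has_meanD (has_meanD M1 M2) M3) M4) M5)).
  by move=> w; field.
by field.
Qed.

Lemma sum_lincomb_sqr_variance (I : Type) (r : seq I) (S : I -> seq (R * R)) :
  (forall i, nonneg_times (S i)) -> (forall i j, 0 <= bm_cov (S i) (S j)) ->
  has_mean P (fun w => (\sum_(i <- r) (L (S i) w ^+ 2 - bm_cov (S i) (S i))) ^+ 2)
    (2 * \sum_(i <- r) \sum_(j <- r) bm_cov (S i) (S j) ^+ 2).
Proof.
move=> S0 c0.
have M i j : has_mean P (fun w => (L (S i) w ^+ 2 - bm_cov (S i) (S i)) *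
    (L (S j) w ^+ 2 - bm_cov (S j) (S j))) (2 * bm_cov (S i) (S j) ^+ 2).
  have M1 := lincomb_sqr_sqr (S0 i) (S0 j) (c0 i i) (c0 j j) (c0 i j).
  have M2 := has_meanZ (- bm_cov (S j) (S j)) (lincomb_moments (S0 i) (c0 i i)).1.
  have M3 := has_meanZ (- bm_cov (S i) (S i)) (lincomb_moments (S0 j) (c0 j j)).1.
  have M4 := has_mean_cst P (bm_cov (S i) (S i) * bm_cov (S j) (S j)).
  apply: (eq_has_mean _ _ (has_meanD (has_meanD (has_meanD M1 M2) M3) M4)).
    by move=> w; ring.
  by ring.
apply: (eq_has_mean _ _ (has_mean_sum r (fun i => has_mean_sum r (M i)))).
  by move=> w; rewrite expr2 mulr_suml; apply: eq_bigr => i _; rewrite mulr_sumr.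
by rewrite mulr_sumr; apply: eq_bigr => i _; rewrite mulr_sumr.
Qed.

Lemma brownian_motion_at0 : {ae P, forall w, W 0 w = 0}.
Proof.
have [mW lawW] := @lincomb_gaussian [:: (1, 0)] (introT andP (conj (lexx _) isT)).
exists (W 0 @^-1` [set~ 0]).
have mC : measurable [set~ 0 : R] by apply: measurableC; exact: measurable_set1.
have W0E : (fun w => lincomb (W^~ w) [:: (1, 0)]) = W 0.
  by apply/funext => w; rewrite /lincomb big_seq1 mul1r.
split.
- rewrite -[_ @^-1` _]setTI -W0E; exact: mW.
- rewrite -W0E lawW//.
  rewrite /centered_gaussian_law /bm_cov !big_seq1/= minxx mulr0 eqxx.
  by rewrite diracE memNset //= => /(_ erefl).
- by move=> w /= ?.
Qed.

End brownian_moments.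

(** * Digit counting and covariances *)

Lemma sum_aligned_minn (B i j : nat) : (0 < B)%N ->
  (minn (i.+1 * B) j.+1 + minn (i * B) j =
   minn (i.+1 * B) j + minn (i * B) j.+1 + (j %/ B == i))%N.
Proof.
move=> B0; have := ltn_pmod j B0; rewrite {2 3 4 5}(divn_eq j B).
set q := (j %/ B)%N; set m := (j %% B)%N; move=> mB.
have [qi|qi|->] := ltngtP q i; rewrite /=.
- by have : (q.+1 * B <= i * B)%N; [rewrite leq_mul2r qi orbT|rewrite !mulSn; lia].
- by have : (i.+1 * B <= q * B)%N; [rewrite leq_mul2r qi orbT|rewrite !mulSn; lia].
- by rewrite !mulSn; lia.
Qed.

(** The residue [k %% b ^ r] is encoded by its [r] lowest b-adic digits; the
    condition says that they are the leading digits among the [s] lowest digits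
    of [l], i.e. that the interval of level [s] attached to [l] lies in the one
    of level [r] attached to [k]. *)
Definition aligned (b r s k l : nat) : bool :=
  ((l %% b ^ s) %/ b ^ (s - r) == k %% b ^ r)%N.

Lemma count_digits (b n s e : nat) (a : pred nat) : (0 < b)%N ->
  (s <= n)%N ->
  (forall l m, a l -> a m -> (l %/ b ^ s = m %/ b ^ s)%N ->
     (l %% b ^ e = m %% b ^ e)%N -> l = m) ->
  (\sum_(0 <= l < b ^ n) a l <= b ^ (n - s) * b ^ e)%N.
Proof.
move=> b0 sn inj; rewrite big_mkord.
rewrite (eq_bigr (fun l : 'I_(b ^ n) => if a l then 1 else 0)%N); last first.
  by move=> l _; case: (a l).
rewrite -big_mkcond/= sum1dep_card.
have qlt (l : 'I_(b ^ n)) : (l %/ b ^ s < b ^ (n - s))%N.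
  by rewrite ltn_divLR ?expn_gt0 ?b0// -expnD subnK.
have rlt (l : 'I_(b ^ n)) : (l %% b ^ e < b ^ e)%N.
  by rewrite ltn_pmod// expn_gt0 b0.
pose f l := (Ordinal (qlt l), Ordinal (rlt l)).
have -> : (b ^ (n - s) * b ^ e = #|{: 'I_(b ^ (n - s)) * 'I_(b ^ e)}|)%N.
  by rewrite card_prod !card_ord.
apply: (@leq_card_in _ _ f) => l m; rewrite !inE => al am [lm1 lm2].
exact/val_inj/inj.
Qed.

Lemma count_aligned (b n r s k : nat) : (0 < b)%N -> (r <= s)%N -> (s <= n)%N ->
  (\sum_(0 <= l < b ^ n) aligned b r s k l <= b ^ (n - r))%N.
Proof.
move=> b0 rs sn; have := @count_digits b n s (s - r) (aligned b r s k) b0 sn.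
rewrite -expnD addnBA// subnK//; apply => l m /eqP al /eqP am lm1 lm2.
rewrite (divn_eq l (b ^ s)) (divn_eq m (b ^ s)) lm1; congr addn.
rewrite (divn_eq (l %% b ^ s) (b ^ (s - r))) (divn_eq (m %% b ^ s) (b ^ (s - r))).
by rewrite al am !modn_dvdm ?lm2// dvdn_exp2l// leq_subr.
Qed.

(** With [e = s - r], alignment of [k] with itself means
    [k = b ^ e * k + k %% b ^ e] modulo [b ^ s], and [b ^ e - 1] is invertible
    modulo [b ^ s]. *)
Lemma count_aligned_diag (b n r s : nat) : (1 < b)%N -> (r < s)%N -> (s <= n)%N ->
  (\sum_(0 <= k < b ^ n) aligned b r s k k <= b ^ (n - r))%N.
Proof.
move=> b1 rs sn; have b0 := ltnW b1.
have := @count_digits b n s (s - r) (fun k => aligned b r s k k) b0 sn.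
rewrite -expnD addnBA ?(ltnW rs)// subnK//; apply => l m al am lm1 lm2.
have key k : aligned b r s k k -> (k = k * b ^ (s - r) + k %% b ^ (s - r) %[mod b ^ s])%N.
  move=> /eqP ak; rewrite -[in LHS](modn_mod k) (divn_eq (k %% b ^ s) (b ^ (s - r))) ak.
  rewrite modn_dvdm ?dvdn_exp2l ?leq_subr//.
  have -> : (b ^ s = b ^ r * b ^ (s - r))%N by rewrite -expnD subnKC// ltnW.
  by rewrite -modnDml -muln_modl modn_mod muln_modl modnDml.
have e0 : (0 < s - r)%N by rewrite subn_gt0.
suff lm : (l = m %[mod b ^ s])%N.
  by rewrite (divn_eq l (b ^ s)) (divn_eq m (b ^ s)) lm1 lm.
wlog le_lm : l m al am lm1 lm2 / (l <= m)%N.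
  by move=> H; have [/H|/ltnW/H] := leqP l m; [exact|move=> /(_ am al)->].
apply/esym/eqP; rewrite eqn_mod_dvd//.
have cop : coprime (b ^ s) (b ^ (s - r)).-1.
  rewrite coprime_pexpl ?(leq_ltn_trans _ rs)//.
  by rewrite -(@coprime_pexpl (s - r))// coprimenP// expn_gt0 b0.
rewrite -(Gauss_dvdr _ cop).
have : (m + l * b ^ (s - r) = l + m * b ^ (s - r) %[mod b ^ s])%N.
  rewrite -modnDml (key m am) -[in RHS]modnDml (key l al) !modnDml lm2.
  by congr modn; lia.
have : (0 < b ^ (s - r))%N by rewrite expn_gt0 b0.
case: (b ^ (s - r))%N => // B _ /esym/eqP; rewrite eqn_mod_dvd ?mulnS/=.
  by congr (_ %| _)%N; rewrite mulnBr !(mulnC B); lia.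
by rewrite addnCA !leq_add2l leq_mul2r le_lm orbT.
Qed.

Section covariance_structure.
Context {R : realType}.
Variables (alpha : R) (b : nat).
Hypotheses (alpha01 : 0 < alpha < 1) (b_gt1 : (1 < b)%N)
  (alpha2b : alpha ^+ 2 * b%:R = 1).
Implicit Types (f : R -> R) (n r s k l K : nat).

Let alpha_gt0 : 0 < alpha. Proof. by case/andP: alpha01. Qed.
Let b_gt0 : (0 < b)%N. Proof. exact: ltnW. Qed.
Let bR_gt0 : 0 < b%:R :> R. Proof. by rewrite ltr0n. Qed.
Let bR_neq0 : b%:R != 0 :> R. Proof. by rewrite gt_eqF. Qed.
Let alpha_neq0 : alpha != 0. Proof. by rewrite gt_eqF. Qed.

Let bE r : b%:R ^- r = alpha ^+ (r + r) :> R.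
Proof.
have -> : b%:R = alpha ^- 2 :> R.
  by apply: (mulfI (expf_neq0 2 alpha_neq0)); rewrite alpha2b divff ?expf_neq0.
by rewrite exprVn invrK -exprM mul2n addnn.
Qed.

Definition node r k : R := k%:R / b%:R ^+ r.

Definition incr f r k : R := f (node r (k %% b ^ r).+1) - f (node r (k %% b ^ r)).

Definition wsum f n k : R := \sum_(1 <= r < n.+1) alpha ^- r * incr f r k.

Definition lvl r k : seq (R * R) :=
  [:: (1, node r (k %% b ^ r).+1); (- 1, node r (k %% b ^ r))].

Definition wcomb n k : seq (R * R) :=
  flatten [seq scale_comb (alpha ^- r) (lvl r k) | r <- index_iota 1 n.+1].

Lemma lincomb_wcomb f n k : lincomb f (wcomb n k) = wsum f n k.
Proof.
rewrite /lincomb big_flatten/= big_map; apply: eq_bigr => r _.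
rewrite [LHS](lincomb_scale f (alpha ^- r) (lvl r k)) /lincomb !big_cons big_nil/=.
by rewrite mul1r mulN1r addr0.
Qed.

Lemma nonneg_times_wcomb n k : nonneg_times (wcomb n k).
Proof.
apply/allP => x /flattenP[s /mapP[r _ ->]]; rewrite /scale_comb/= !inE.
by move=> /orP[] /eqP -> /=; rewrite divr_ge0// exprn_ge0.
Qed.

Definition level_cov r s k l : R :=
  if (r <= s)%N then alpha ^+ (s - r) * (aligned b r s k l)%:R
  else alpha ^+ (r - s) * (aligned b s r l k)%:R.

Lemma bm_cov_lvl r s k l : (r <= s)%N ->
  bm_cov (lvl r k) (lvl s l) = (aligned b r s k l)%:R / b%:R ^+ s.
Proof.
move=> rs; rewrite /bm_cov !big_cons !big_nil/= /node.
rewrite !addr0 !mul1r mulN1r mulNr mulN1r opprK mul1r.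
have B0 : (0 < b ^ (s - r))%N by rewrite expn_gt0 b_gt0.
have nr i : i%:R / b%:R ^+ r = (i * b ^ (s - r))%:R / b%:R ^+ s :> R.
  rewrite natrM natrX -{2}(subnK rs) exprD invfM.
  by rewrite mulrA mulfK// expf_neq0.
have bs0 : 0 <= b%:R ^- s :> R by rewrite invr_ge0 exprn_ge0.
have mn i j : Num.min (i%:R / b%:R ^+ s) (j%:R / b%:R ^+ s) =
    (minn i j)%:R / b%:R ^+ s :> R.
  by rewrite -minr_pMl// natr_min.
rewrite !nr !mn.
have := sum_aligned_minn (k %% b ^ r) (l %% b ^ s) B0.
rewrite -/(aligned b r s k l).
move=> /(congr1 (fun i => i%:R : R)); rewrite !natrD => E.
move: E; set x1 := (minn _ _)%:R; set x2 := (minn _ _)%:R.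
set x3 := (minn _ _)%:R; set x4 := (minn _ _)%:R => E.
have -> : (aligned b r s k l)%:R = x1 + x2 - x3 - x4 by move: E; lra.
by rewrite /x1 /x2 /x3 /x4; ring.
Qed.

Lemma scaled_bm_cov_lvl r s k l :
  alpha ^- r * (alpha ^- s * bm_cov (lvl r k) (lvl s l)) = level_cov r s k l.
Proof.
have H i j : (i <= j)%N -> alpha ^- i * alpha ^- j * b%:R ^- j = alpha ^+ (j - i).
  move=> ij; rewrite bE exprD -{2}(subnK ij) exprD.
  by field; rewrite ?expf_neq0.
rewrite /level_cov; case: leqP => [rs|/ltnW sr].
  by rewrite bm_cov_lvl// -(H _ _ rs); ring.
by rewrite bm_covC bm_cov_lvl// -(H _ _ sr); ring.
Qed.

Lemma bm_cov_flattenl (ss : seq (seq (R * R))) u :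
  bm_cov (flatten ss) u = \sum_(s <- ss) bm_cov s u.
Proof. exact: big_flatten. Qed.

Lemma bm_cov_wcomb n k l : bm_cov (wcomb n k) (wcomb n l) =
  \sum_(1 <= r < n.+1) \sum_(1 <= s < n.+1) level_cov r s k l.
Proof.
rewrite bm_cov_flattenl big_map; apply: eq_bigr => r _.
rewrite bm_covC bm_cov_flattenl big_map; apply: eq_bigr => s _.
by rewrite bm_cov_scalel bm_cov_scaler bm_covC -scaled_bm_cov_lvl mulrCA.
Qed.

Lemma level_cov_ge0 r s k l : 0 <= level_cov r s k l.
Proof. by rewrite /level_cov; case: ifP => _; rewrite mulr_ge0// exprn_ge0// ltW. Qed.

Lemma level_cov_le1 r s k l : level_cov r s k l <= 1.
Proof.
have /andP[_ /ltW a1] := alpha01.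
by rewrite /level_cov; case: ifP => _; rewrite mulr_ile1 ?lern1 ?leq_b1// ?exprn_ge0
  ?exprn_ile1// ltW.
Qed.

Lemma level_cov_diag r k : level_cov r r k k = 1.
Proof. by rewrite /level_cov leqnn subnn /aligned subnn expn0 divn1 eqxx mulr1. Qed.

End covariance_structure.

Lemma sum_geometric_le {R : realFieldType} (x : R) (m n : nat) : 0 <= x -> x < 1 ->
  \sum_(m <= r < n) x ^+ r <= (1 - x)^-1.
Proof.
move=> x0 x1; have y0 : 0 < 1 - x by rewrite subr_gt0.
rewrite -div1r ler_pdivlMr//.
have [mn|nm] := leqP m n; last first.
  by rewrite big_geq ?mul0r// ltnW.
suff -> : (\sum_(m <= r < n) x ^+ r) * (1 - x) = x ^+ m - x ^+ n.
  by rewrite lerBlDr (le_trans (exprn_ile1 _ x0 (ltW x1)))// lerDl exprn_ge0.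
elim: n mn => [|n IH]; first by rewrite leqn0 => /eqP->; rewrite big_geq// mul0r subrr.
rewrite leq_eqVlt => /orP[/eqP->|]; first by rewrite big_geq// mul0r subrr.
by rewrite ltnS => mn; rewrite big_nat_recr//= mulrDl IH// exprS; ring.
Qed.

Lemma cauchy_schwarz_weights {R : realFieldType} (I : Type) (r : seq I) (w x : I -> R) :
  (forall i, 0 < w i) ->
  (\sum_(i <- r) x i) ^+ 2 <= (\sum_(i <- r) w i) * \sum_(i <- r) x i ^+ 2 / w i.
Proof.
move=> w0; elim: r => [|i r IH]; first by rewrite !big_nil mul0r expr0n.
rewrite !big_cons; move: IH.
have : 0 <= \sum_(j <- r) w j by apply: sumr_ge0 => j _; exact: ltW.
have : 0 <= \sum_(j <- r) x j ^+ 2 / w j.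
  by apply: sumr_ge0 => j _; rewrite divr_ge0 ?sqr_ge0// ltW.
have wi := w0 i; have q0 : 0 <= x i ^+ 2 / w i by rewrite divr_ge0 ?sqr_ge0// ltW.
have qE : x i ^+ 2 = w i * (x i ^+ 2 / w i) by field; rewrite gt_eqF.
move: (x i ^+ 2 / w i) q0 qE => q q0 qE.
move: (\sum_(j <- r) x j) (\sum_(j <- r) w j) (\sum_(j <- r) x j ^+ 2 / w j).
move=> S A B B0 A0 SAB.
suff : 2 * x i * S <= w i * B + A * q.
  by rewrite sqrrD qE; move: SAB; lra.
have z0 : 0 <= w i * B + A * q by rewrite addr_ge0// mulr_ge0// ltW.
rewrite real_leNgt ?num_real//; apply/negP => lt.
have : (w i * B + A * q) ^+ 2 < (2 * x i * S) ^+ 2.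
  by rewrite ltr_pXn2r ?nnegrE// (le_trans z0)// ltW.
apply/negP; rewrite -leNgt.
have -> : (2 * x i * S) ^+ 2 = 4 * (w i * q) * S ^+ 2 by rewrite -qE; ring.
apply: (@le_trans _ _ (4 * (w i * q) * (A * B))).
  by rewrite ler_wpM2l// mulr_ge0// mulr_ge0// ltW.
rewrite -subr_ge0 (_ : _ - _ = (w i * B - A * q) ^+ 2) ?sqr_ge0//; ring.
Qed.

Section covariance_sums.
Context {R : realType}.
Variables (alpha : R) (b : nat).
Hypotheses (alpha01 : 0 < alpha < 1) (b_gt1 : (1 < b)%N)
  (alpha2b : alpha ^+ 2 * b%:R = 1).
Implicit Types (n r s k l K : nat).

Let alpha_gt0 : 0 < alpha. Proof. by case/andP: alpha01. Qed.
Let alpha_lt1 : alpha < 1. Proof. by case/andP: alpha01. Qed.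
Let b_gt0 : (0 < b)%N. Proof. exact: ltnW. Qed.

Let powM n r : (r <= n)%N -> (b ^ (n - r))%:R = (b ^ n)%:R * alpha ^+ (r + r) :> R.
Proof.
move=> rn; rewrite -{2}(subnK rn) expnD natrM addnn -mul2n exprM.
by rewrite (natrX _ b r) -mulrA -exprMn [b%:R * _]mulrC alpha2b expr1n mulr1.
Qed.

Local Notation g := (level_cov alpha b).
Local Notation C := (wcomb alpha b).

Lemma sum_level_cov_diag n r s : r != s -> (r <= n)%N -> (s <= n)%N ->
  \sum_(0 <= k < b ^ n) g r s k k <= (b ^ n)%:R * (alpha ^+ r * alpha ^+ s).
Proof.
have H i j : (i < j)%N -> (j <= n)%N ->
    \sum_(0 <= k < b ^ n) alpha ^+ (j - i) * (aligned b i j k k)%:R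
      <= (b ^ n)%:R * (alpha ^+ i * alpha ^+ j).
  move=> ij jn; have lij := ltnW ij; rewrite -mulr_sumr -natr_sum.
  apply: (@le_trans _ _ (alpha ^+ (j - i) * (b ^ (n - i))%:R)).
    by rewrite ler_pM2l ?exprn_gt0// ler_nat count_aligned_diag.
  rewrite powM ?(leq_trans lij)// mulrCA -!exprD.
  by rewrite addnA subnK// addnC.
rewrite neq_ltn => /orP[rs|sr] rn sn.
  by under eq_bigr do rewrite /level_cov (ltnW rs); exact: H.
under eq_bigr do rewrite /level_cov leqNgt sr/=.
by rewrite [X in _ <= _ * X]mulrC; exact: H.
Qed.

Lemma sum_sqr_level_cov n r s : (r <= n)%N -> (s <= n)%N ->
  \sum_(0 <= k < b ^ n) \sum_(0 <= l < b ^ n) g r s k l ^+ 2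
    <= (b ^ n)%:R ^+ 2 * (alpha ^+ r * alpha ^+ s).
Proof.
have H i j : (i <= j)%N -> (j <= n)%N ->
    \sum_(0 <= k < b ^ n) \sum_(0 <= l < b ^ n)
       (alpha ^+ (j - i) * (aligned b i j k l)%:R) ^+ 2
      <= (b ^ n)%:R ^+ 2 * (alpha ^+ i * alpha ^+ j).
  move=> ij jn.
  apply: (@le_trans _ _ (\sum_(0 <= k < b ^ n) (b ^ n)%:R * (alpha ^+ i * alpha ^+ j))).
    apply: ler_sum => k _.
    under eq_bigr => l _.
      rewrite exprMn (_ : _%:R ^+ 2 = (aligned b i j k l)%:R); first over.
      by case: (aligned _ _ _ _ _); rewrite ?expr1n ?expr0n.
    rewrite -mulr_sumr -natr_sum.
    apply: (@le_trans _ _ (alpha ^+ (j - i) ^+ 2 * (b ^ (n - i))%:R)).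
      by rewrite ler_pM2l ?exprn_gt0// ler_nat count_aligned.
    rewrite powM ?(leq_trans ij)// mulrCA ler_pM2l ?ltr0n ?expn_gt0 ?b_gt0//.
    rewrite -exprM -!exprD ler_wiXn2l// ?ltW//; lia.
  by rewrite sumr_const_nat subn0 -[X in X <= _]mulr_natl mulrA expr2.
have [rs|/ltnW sr] := leqP r s => rn sn.
  under eq_bigr do under eq_bigr do rewrite /level_cov rs.
  exact: H.
rewrite exchange_big/= [X in _ <= _ * X]mulrC.
apply: le_trans (H _ _ sr rn); rewrite le_eqVlt; apply/orP; left; apply/eqP.
apply: eq_bigr => k _; apply: eq_bigr => l _; rewrite /level_cov.
case: leqP => // rs; have -> : r = s by apply/eqP; rewrite eqn_leq rs.
by rewrite /aligned !subnn !expn0 !divn1 eq_sym.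
Qed.

Lemma wcomb_cov_ge0 n k l : 0 <= bm_cov (C n k) (C n l).
Proof.
rewrite (bm_cov_wcomb alpha01 b_gt1 alpha2b).
by apply: sumr_ge0 => r _; apply: sumr_ge0 => s _; exact: level_cov_ge0.
Qed.

Lemma wcomb_var_le n k : bm_cov (C n k) (C n k) <= n%:R ^+ 2.
Proof.
rewrite (bm_cov_wcomb alpha01 b_gt1 alpha2b).
apply: (@le_trans _ _ (\sum_(1 <= r < n.+1) \sum_(1 <= s < n.+1) 1)).
  by apply: ler_sum => r _; apply: ler_sum => s _; exact: level_cov_le1.
rewrite (eq_bigr (fun=> n%:R)); last by move=> i _; rewrite sumr_const_nat subSS subn0.
by rewrite sumr_const_nat subSS subn0 -[X in X <= _]mulr_natl expr2.
Qed.

Lemma wcomb_var_ge n k : n%:R <= bm_cov (C n k) (C n k).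
Proof.
rewrite (bm_cov_wcomb alpha01 b_gt1 alpha2b).
apply: (@le_trans _ _ (\sum_(1 <= r < n.+1) 1)).
  by rewrite sumr_const_nat subSS subn0.
apply: ler_sum_nat => r rn; rewrite (bigD1_seq r) ?iota_uniq//= ?mem_index_iota//.
rewrite level_cov_diag lerDl; apply: sumr_ge0 => s _; exact: level_cov_ge0.
Qed.

Lemma sum_wcomb_var_le n K : (K <= b ^ n)%N ->
  \sum_(0 <= k < K) bm_cov (C n k) (C n k)
    <= n%:R * K%:R + (b ^ n)%:R * (1 - alpha) ^- 2.
Proof.
move=> Kn.
pose off k := \sum_(1 <= r < n.+1) \sum_(1 <= s < n.+1 | r != s) g r s k k.
have covE k : bm_cov (C n k) (C n k) = n%:R + off k.
  rewrite (bm_cov_wcomb alpha01 b_gt1 alpha2b) /off.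
  rewrite (_ : n%:R = \sum_(1 <= r < n.+1) 1); last by rewrite sumr_const_nat subSS subn0.
  rewrite -big_split/=; apply: eq_big_nat => r rn.
  rewrite (bigD1_seq r) ?iota_uniq//= ?mem_index_iota// level_cov_diag.
  by congr (_ + _); apply: eq_bigl => s; rewrite eq_sym.
have off0 k : 0 <= off k.
  by apply: sumr_ge0 => r _; apply: sumr_ge0 => s _; exact: level_cov_ge0.
under eq_bigr do rewrite covE.
rewrite big_split/= sumr_const_nat subn0 mulr_natr lerD2l.
apply: (@le_trans _ _ (\sum_(0 <= k < b ^ n) off k)).
  by rewrite [leRHS](big_cat_nat (n := K))//= lerDl sumr_ge0.
rewrite /off exchange_big/=.
apply: (@le_trans _ _ (\sum_(1 <= r < n.+1) \sum_(1 <= s < n.+1)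
   (b ^ n)%:R * (alpha ^+ r * alpha ^+ s))).
  apply: ler_sum_nat => r /andP[_ rn]; rewrite exchange_big/= big_mkcond/=.
  apply: ler_sum_nat => s /andP[_ sn]; case: ifP => [rs|_].
    exact: sum_level_cov_diag.
  by rewrite !mulr_ge0// exprn_ge0// ltW.
under eq_bigr do rewrite -mulr_sumr -mulr_sumr.
rewrite -mulr_sumr -mulr_suml ler_pM2l ?ltr0n ?expn_gt0 ?b_gt0// -expr2.
rewrite -exprVn ler_pXn2r ?nnegrE//.
- by apply: sum_geometric_le => //; exact: ltW.
- by apply: sumr_ge0 => r _; rewrite exprn_ge0// ltW.
- by rewrite invr_ge0 subr_ge0 ltW.
Qed.

Lemma sum_sqr_wcomb_cov_le n K : (K <= b ^ n)%N ->
  \sum_(0 <= k < K) \sum_(0 <= l < K) bm_cov (C n k) (C n l) ^+ 2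
    <= (b ^ n)%:R ^+ 2 * (1 - Num.sqrt alpha) ^- 4.
Proof.
move=> Kn; set theta := Num.sqrt alpha.
have th0 : 0 < theta by rewrite sqrtr_gt0.
have th2 : theta ^+ 2 = alpha by rewrite sqr_sqrtr// ltW.
have th1 : theta < 1 by rewrite -sqrtr1 ltr_sqrt.
pose A := \sum_(1 <= r < n.+1) theta ^+ r.
have A0 : 0 <= A by apply: sumr_ge0 => r _; rewrite exprn_ge0// ltW.
have A1 : A <= (1 - theta)^-1 by rewrite sum_geometric_le// ltW.
apply: (@le_trans _ _ (\sum_(0 <= k < b ^ n) \sum_(0 <= l < b ^ n)
    bm_cov (C n k) (C n l) ^+ 2)).
  have sq0 (F : nat -> R) : (forall k, 0 <= F k) ->
      \sum_(0 <= k < K) F k <= \sum_(0 <= k < b ^ n) F k.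
    by move=> F0; rewrite [leRHS](big_cat_nat (n := K))//= lerDl sumr_ge0.
  apply: le_trans (sq0 _ _); last by move=> k; apply: sumr_ge0 => l _; exact: sqr_ge0.
  by apply: ler_sum => k _; apply: sq0 => l; exact: sqr_ge0.
have tw r : 0 < theta ^+ r by rewrite exprn_gt0.
have CS k l : bm_cov (C n k) (C n l) ^+ 2 <=
    A ^+ 2 * \sum_(1 <= r < n.+1) \sum_(1 <= s < n.+1)
      g r s k l ^+ 2 / (theta ^+ r * theta ^+ s).
  rewrite (bm_cov_wcomb alpha01 b_gt1 alpha2b).
  apply: le_trans (cauchy_schwarz_weights _ _ tw) _.
  rewrite -/A expr2 -mulrA ler_wpM2l// mulr_sumr; apply: ler_sum => r _.
  rewrite ler_pdivrMr//; apply: le_trans (cauchy_schwarz_weights _ _ tw) _.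
  rewrite -/A -mulrA ler_wpM2l// mulr_suml; apply: ler_sum => s _.
  by rewrite le_eqVlt; apply/orP; left; apply/eqP; field; rewrite !gt_eqF.
apply: (@le_trans _ _ (A ^+ 2 * \sum_(1 <= r < n.+1) \sum_(1 <= s < n.+1)
    (b ^ n)%:R ^+ 2 * (theta ^+ r * theta ^+ s))).
  apply: (@le_trans _ _ (\sum_(0 <= k < b ^ n) \sum_(0 <= l < b ^ n)
      A ^+ 2 * \sum_(1 <= r < n.+1) \sum_(1 <= s < n.+1)
      g r s k l ^+ 2 / (theta ^+ r * theta ^+ s))).
    by apply: ler_sum => k _; apply: ler_sum => l _.
  under eq_bigr do rewrite -mulr_sumr.
  rewrite -mulr_sumr ler_wpM2l ?sqr_ge0//.
  under eq_bigr do rewrite exchange_big/=.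
  rewrite exchange_big/=; apply: ler_sum_nat => r /andP[_ rn].
  under eq_bigr do rewrite exchange_big/=.
  rewrite exchange_big/=; apply: ler_sum_nat => s /andP[_ sn].
  under eq_bigr do rewrite -mulr_suml.
  rewrite -mulr_suml ler_pdivrMr ?mulr_gt0// -mulrA -!exprD.
  apply: le_trans (sum_sqr_level_cov _ _) _ => //.
  by rewrite -th2 -!exprM -!exprD -!mulnDr mul2n addnn.
under eq_bigr do rewrite -mulr_sumr -mulr_sumr.
rewrite -mulr_sumr -mulr_suml -/A mulrCA ler_pM2l; last first.
  by rewrite exprn_gt0// ltr0n expn_gt0 b_gt0.
by rewrite -expr2 -exprD -exprVn ler_pXn2r ?nnegrE// invr_ge0 subr_ge0 ltW.
Qed.

End covariance_sums.

(** * Almost sure limits of the Gaussian sums *)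

Lemma sum_inv_sqr_le {R : realFieldType} N : \sum_(0 <= n < N) n%:R ^- 2 <= 2 :> R.
Proof.
have H M : \sum_(1 <= n < M.+2) n%:R ^- 2 <= 2 - M.+1%:R^-1 :> R.
  elim: M => [|M IH]; first by rewrite big_nat1 expr1n invr1 lerBrDr.
  rewrite big_nat_recr//=; apply: le_trans (lerD IH (lexx _)) _.
  rewrite -addrA lerD2l -lerBrDl opprK addrC.
  have M0 : 0 < M.+1%:R :> R by rewrite ltr0n.
  have M1 : 0 < M.+2%:R :> R by rewrite ltr0n.
  rewrite (_ : _ - _ = (M.+1%:R * M.+2%:R)^-1).
    rewrite lef_pV2 ?posrE ?mulr_gt0 ?exprn_gt0// expr2 ler_pM2r//.
    by rewrite ler_nat.
  have -> : M.+2%:R = M.+1%:R + 1 :> R by rewrite -natr1.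
  have M2 : M.+1%:R + 1 != 0 :> R by rewrite natr1 pnatr_eq0.
  move: (M.+1%:R : R) M0 M2 => m m0 m1; field.
  by rewrite m1 gt_eqF.
case: N => [|[|M]]; first by rewrite big_geq.
  by rewrite big_nat1 expr0n invr0.
rewrite big_nat_recl// expr0n invr0 add0r.
by have := H M; rewrite big_add1 => /le_trans; apply; rewrite gerBl invr_ge0.
Qed.

Lemma poly_geometric_bounded {R : rcfType} (j : nat) (x : R) : 0 < x < 1 ->
  exists2 C, 0 <= C & forall n, n%:R ^+ j * x ^+ n <= C.
Proof.
elim: j x => [|j IH] x /andP[x0 x1].
  by exists 1 => // n; rewrite mul1r exprn_ile1// ltW.
pose y := Num.sqrt x; have y0 : 0 < y by rewrite sqrtr_gt0.
have y1 : y < 1 by rewrite -sqrtr1 ltr_sqrt.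
have yx : y ^+ 2 = x by rewrite sqr_sqrtr// ltW.
have [|C C0 hC] := IH y; first by rewrite y0.
have D0 : 0 <= (1 - y)^-1 by rewrite invr_ge0 subr_ge0 ltW.
exists (C * (1 - y)^-1) => [|n]; first exact: mulr_ge0.
have hn : n%:R * y ^+ n <= (1 - y)^-1.
  apply: le_trans (sum_geometric_le 0 n (ltW y0) y1).
  rewrite mulr_natl -[X in _ *+ X <= _]subn0 -sumr_const_nat; apply: ler_sum_nat => i /andP[_ ilt].
  by apply: ler_wiXn2l; [exact: ltW|exact: ltW|exact: ltnW].
have -> : n%:R ^+ j.+1 * x ^+ n = (n%:R ^+ j * y ^+ n) * (n%:R * y ^+ n).
  by rewrite -yx exprAC expr2 exprS; ring.
by apply: ler_pM; rewrite ?hC ?hn ?mulr_ge0 ?exprn_ge0// ltW.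
Qed.

Lemma cvg0_of_sqr {R : realType} (u : nat -> R) :
  (fun n => u n ^+ 2) @ \oo --> (0 : R) -> u @ \oo --> (0 : R).
Proof.
move=> u2; apply: norm_cvg0.
have : (fun n => Num.sqrt (u n ^+ 2)) @ \oo --> Num.sqrt (0 : R).
  by apply: continuous_cvg => //; exact: sqrt_continuous.
by rewrite sqrtr0; under eq_fun do rewrite sqrtr_sqr.
Qed.

Lemma cvg_inv_nat {R : realType} : (fun n : nat => n%:R^-1) @ \oo --> (0 : R).
Proof.
by have := @cvg_harmonic R; rewrite -(@cvg_shiftS R (fun n : nat => n%:R^-1)).
Qed.

Section gaussian_sums.
Context {d : measure_display} {T : measurableType d} {R : realType}.
Variables (P : probability T R) (W : R -> T -> R) (alpha : R) (b : nat).
Hypotheses (BM : standard_brownian_motion P W)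
  (alpha01 : 0 < alpha < 1) (b_gt1 : (1 < b)%N)
  (alpha2b : alpha ^+ 2 * b%:R = 1).

Let alpha_gt0 : 0 < alpha. Proof. by case/andP: alpha01. Qed.
Let alpha_lt1 : alpha < 1. Proof. by case/andP: alpha01. Qed.
Let b_gt0 : (0 < b)%N. Proof. exact: ltnW. Qed.

Local Notation S := (fun n k w => wsum alpha b (W^~ w) n k).
Local Notation C := (wcomb alpha b).
Local Notation K t n := (Num.truncn (t * b%:R ^+ n)).

Lemma alpha_sqr_pow n : (alpha ^+ n) ^+ 2 = (b ^ n)%:R^-1.
Proof.
have bn0 : (b ^ n)%:R != 0 :> R by rewrite gt_eqF// ltr0n expn_gt0 b_gt0.
apply: (mulIf bn0); rewrite mulVf// natrX -exprM mulnC exprM -exprMn alpha2b.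
by rewrite expr1n.
Qed.

Lemma truncn_badic_le (t : R) n : 0 <= t <= 1 -> (K t n <= b ^ n)%N.
Proof.
move=> /andP[t0 t1]; rewrite -(ler_nat R).
have bn0 : 0 <= b%:R ^+ n :> R by rewrite exprn_ge0.
have := truncn_le (t * b%:R ^+ n); rewrite mulr_ge0// => /le_trans; apply.
by rewrite natrX ler_piMl.
Qed.

Lemma cvg_truncn_badic (t : R) : 0 <= t ->
  (fun n => (alpha ^+ n) ^+ 2 * (K t n)%:R) @ \oo --> t.
Proof.
move=> t0.
have bn0 n : 0 < (b ^ n)%:R :> R by rewrite ltr0n expn_gt0 b_gt0.
apply: (@squeeze_cvgr _ _ _ _ (fun n => t - (alpha ^+ 2) ^+ n) (fun=> t)).
- apply: nearW => n; rewrite alpha_sqr_pow -exprM mulnC exprM alpha_sqr_pow.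
  have := @truncn_itv _ (t * b%:R ^+ n); rewrite mulr_ge0 ?exprn_ge0// => /(_ isT).
  rewrite -natrX -natr1 => /andP[h1 h2].
  rewrite mulrC ler_pdivlMr// ler_pdivrMr// h1 andbT mulrBl mulVf ?gt_eqF//.
  by rewrite lerBlDr ltW.
- rewrite -[X in _ --> X]subr0; apply: cvgB; first exact: cvg_cst.
  apply: cvg_expr; rewrite ger0_norm ?exprn_ge0// ?ltW// expr_lt1// ltW//.
- exact: cvg_cst.
Qed.

Lemma ae_mean_square_cvg (t : R) : 0 <= t <= 1 ->
  {ae P, forall w, (fun n => n%:R^-1 *
     \sum_(0 <= k < K t n) (alpha ^+ n * S n k w) ^+ 2) @ \oo --> t}.
Proof.
move=> t01; have Kn n := truncn_badic_le n t01.
have bn0 n : 0 < (b ^ n)%:R :> R by rewrite ltr0n expn_gt0 b_gt0.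
pose c n : R := n%:R^-1 * (alpha ^+ n) ^+ 2.
pose D w n := \sum_(k <- index_iota 0 (K t n))
  (lincomb (W^~ w) (C n k) ^+ 2 - bm_cov (C n k) (C n k)).
pose C2 := (1 - Num.sqrt alpha) ^- 4.
have : {ae P, forall w, (fun n => c n ^+ 2 * D w n ^+ 2) @ \oo --> (0 : R)}.
  apply: (@ae_cvg0_of_summable_means _ _ _ P _
    (fun n => c n ^+ 2 * (2 * \sum_(k <- index_iota 0 (K t n))
       \sum_(l <- index_iota 0 (K t n)) bm_cov (C n k) (C n l) ^+ 2))
    (2 * C2 * 2)).
  - by move=> n w; rewrite mulr_ge0// sqr_ge0.
  - move=> n; apply: has_meanZ.
    apply: (sum_lincomb_sqr_variance BM) => [k|k l]; first exact: nonneg_times_wcomb.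
    exact: wcomb_cov_ge0.
  - move=> N; apply: (@le_trans _ _ (\sum_(0 <= n < N) 2 * C2 * n%:R ^- 2)).
      apply: ler_sum => n _.
      rewrite /c alpha_sqr_pow exprMn -exprVn -[X in _ <= X]mulrC -mulrA ler_wpM2l ?sqr_ge0//.
      rewrite mulrCA ler_pM2l//.
      rewrite exprVn ler_pdivrMl ?exprn_gt0//.
      exact: sum_sqr_wcomb_cov_le.
    rewrite -mulr_sumr ler_wpM2l ?sum_inv_sqr_le// mulr_ge0//.
    by rewrite /C2 invr_ge0 exprn_even_ge0.
apply: filterS => w; under eq_fun do rewrite -exprMn.
move=> /cvg0_of_sqr D0.
have mean : (fun n => c n * \sum_(0 <= k < K t n) bm_cov (C n k) (C n k)) @ \oo --> t.
  apply: (@squeeze_cvgr _ _ _ _ (fun n => (alpha ^+ n) ^+ 2 * (K t n)%:R)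
      (fun n => (alpha ^+ n) ^+ 2 * (K t n)%:R + n%:R^-1 * (1 - alpha) ^- 2)).
  - near=> n; have n0 : 0 < n%:R :> R by rewrite ltr0n; near: n; exists 1%N.
    have a0 : 0 < (alpha ^+ n) ^+ 2 by rewrite !exprn_gt0.
    have -> : (alpha ^+ n) ^+ 2 * (K t n)%:R = c n * (n%:R * (K t n)%:R).
      by rewrite /c; field; rewrite gt_eqF.
    have -> : n%:R^-1 * (1 - alpha) ^- 2 = c n * ((b ^ n)%:R * (1 - alpha) ^- 2).
      rewrite -[(b ^ n)%:R]invrK -alpha_sqr_pow /c.
      by field; rewrite !gt_eqF ?subr_gt0// exprn_gt0.
    have c0 : 0 < c n by rewrite mulr_gt0 ?invr_gt0.
    rewrite -mulrDr !ler_pM2l// sum_wcomb_var_le// andbT.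
    apply: (@le_trans _ _ (\sum_(0 <= k < K t n) n%:R)).
      by rewrite sumr_const_nat subn0 mulr_natr.
    by apply: ler_sum => k _; exact: wcomb_var_ge.
  - by apply: cvg_truncn_badic; case/andP: t01.
  - rewrite -[X in _ --> X]addr0 -[in X in _ --> X](mul0r ((1 - alpha) ^- 2)).
    apply: cvgD; first by apply: cvg_truncn_badic; case/andP: t01.
    apply: cvgM; last exact: cvg_cst.
    exact: cvg_inv_nat.
have lim_sum := cvgD mean D0; rewrite addr0 in lim_sum.
suff -> : (fun n => n%:R^-1 * \sum_(0 <= k < K t n) (alpha ^+ n * S n k w) ^+ 2) =
    (fun n => c n * (\sum_(0 <= k < K t n) bm_cov (C n k) (C n k)) + c n * D w n).
  exact: lim_sum.
apply/funext => n.
rewrite /D sumrB -mulrDr addrC subrK /c -mulrA; congr (_ * _).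
by rewrite mulr_sumr; apply: eq_bigr => k _; rewrite lincomb_wcomb exprMn.
Unshelve. all: end_near. Qed.

Lemma ae_fourth_moment_cvg0 :
  {ae P, forall w, (fun n => alpha ^- n *
     \sum_(0 <= k < b ^ n) (alpha ^+ n * S n k w) ^+ 4) @ \oo --> (0 : R)}.
Proof.
have [C6 C60 hC6] := poly_geometric_bounded 6 alpha01.
apply: (@ae_cvg0_of_summable_means _ _ _ P _
  (fun n => alpha ^- n * ((alpha ^+ n) ^+ 4 *
     \sum_(k <- index_iota 0 (b ^ n)) 3 * bm_cov (C n k) (C n k) ^+ 2))
    (3 * C6 * 2)).
- move=> n w; rewrite mulr_ge0 ?invr_ge0 ?exprn_ge0 ?(ltW alpha_gt0)//.
  by apply: sumr_ge0 => k _; rewrite exprn_even_ge0.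
- move=> n; apply: has_meanZ.
  have H k : has_mean P (fun w => lincomb (W^~ w) (C n k) ^+ 4) (3 * bm_cov (C n k) (C n k) ^+ 2).
    apply: (lincomb_moments BM _ _).2; first exact: nonneg_times_wcomb.
    exact: wcomb_cov_ge0.
  apply: (eq_has_mean _ _ (has_meanZ ((alpha ^+ n) ^+ 4)
    (has_mean_sum (index_iota 0 (b ^ n)) H))) => // w.
  by rewrite mulr_sumr; apply: eq_bigr => k _; rewrite lincomb_wcomb exprMn.
- move=> N; apply: (@le_trans _ _ (\sum_(0 <= n < N) 3 * C6 * n%:R ^- 2)); last first.
    by rewrite -mulr_sumr ler_wpM2l ?sum_inv_sqr_le// mulr_ge0.
  apply: ler_sum => n _.
  have an0 : 0 < alpha ^+ n by rewrite exprn_gt0.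
  apply: (@le_trans _ _ (alpha ^- n * ((alpha ^+ n) ^+ 4 * ((b ^ n)%:R * (3 * (n%:R ^+ 2) ^+ 2))))).
    rewrite !ler_pM2l ?invr_gt0 ?exprn_gt0//.
    rewrite -[X in X%:R * _]subn0 mulr_natl -sumr_const_nat; apply: ler_sum => k _.
    rewrite ler_pM2l// ler_pXn2r ?nnegrE//.
    + exact: wcomb_var_le.
    + exact: wcomb_cov_ge0.
  have -> : (b ^ n)%:R = (alpha ^+ n) ^- 2 :> R by rewrite alpha_sqr_pow invrK.
  have -> : alpha ^- n * ((alpha ^+ n) ^+ 4 * ((alpha ^+ n) ^- 2 * (3 * (n%:R ^+ 2) ^+ 2))) =
     3 * (n%:R ^+ 4 * alpha ^+ n).
    by field; rewrite gt_eqF.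
  rewrite -mulrA ler_pM2l//.
  have [->|n0] := eqVneq n 0%N; first by rewrite !expr0n/= mul0r invr0 mulr0.
  have n1 : 0 < n%:R :> R by rewrite ltr0n lt0n.
  by rewrite ler_pdivlMr ?exprn_gt0// mulrAC -exprD hC6.
Qed.

End gaussian_sums.

(** * Increments of the bridge at b-adic points *)

Section bridge_increments.
Context {R : realType}.
Implicit Types (f kappa : R -> R) (n r k : nat).

Lemma frac_nat k : Defs.frac (k%:R : R) = 0.
Proof.
rewrite /Defs.frac (@floor_def _ _ (Posz k)) ?subrr//.
by rewrite lexx/= -[X in X < _]/((Posz k)%:~R) ltr_int ltzD1.
Qed.

Lemma frac_ratio (m k : nat) : (0 < m)%N ->
  Defs.frac (k%:R / m%:R : R) = (k %% m)%:R / m%:R.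
Proof.
move=> m0; have mR : 0 < m%:R :> R by rewrite ltr0n.
have E : k%:R / m%:R = (k %/ m)%:R + (k %% m)%:R / m%:R :> R.
  by rewrite {1}(divn_eq k m) natrD natrM mulrDl mulfK ?gt_eqF.
have ge0 : 0 <= (k %% m)%:R / m%:R :> R by rewrite divr_ge0.
have lt1 : (k %% m)%:R / m%:R < 1 :> R by rewrite ltr_pdivrMr// mul1r ltr_nat ltn_pmod.
rewrite /Defs.frac (@floor_def _ _ (Posz (k %/ m))); first by rewrite E addrC addKr.
rewrite intrD -[X in X <= _ < X + _]/((k %/ m)%:R) E.
by rewrite lerDl ge0 ltrD2l.
Qed.

Variables (alpha : R) (b : nat).
Hypotheses (alpha01 : 0 < alpha < 1) (b_gt1 : (1 < b)%N).

Let alpha_gt0 : 0 < alpha. Proof. by case/andP: alpha01. Qed.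
Let b_gt0 : (0 < b)%N. Proof. exact: ltnW. Qed.
Let bn_gt0 n : (0 < b ^ n)%N. Proof. by rewrite expn_gt0 b_gt0. Qed.

Section fixed_path.
Variables (f kappa : R -> R).
Hypotheses (f0 : f 0 = 0) (k0 : kappa 0 = 0) (k1 : kappa 1 = 1).
Local Notation B := (bridge f kappa).

Let B0 : B 0 = 0. Proof. by rewrite /bridge f0 k0 mul0r subrr. Qed.
Let B1 : B 1 = 0. Proof. by rewrite /bridge k1 mul1r subrr. Qed.

(** At a b-adic point the defining series is a finite sum, since the bridge
    vanishes at integers. *)
Lemma ww_bridge_badic n k : ww_bridge f kappa alpha b (k%:R / b%:R ^+ n) =
  \sum_(0 <= m < n) alpha ^+ m * B (node b (n - m) (k %% b ^ (n - m))).
Proof.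
apply: lim_near_cst => //; exists n => // N /= nN.
rewrite (big_cat_nat (n := n))//= [X in _ + X](_ : _ = 0) ?addr0; last first.
  rewrite big_nat_cond big1// => m /andP[/andP[nm _] _].
  have -> : b%:R ^+ m * (k%:R / b%:R ^+ n) = (b ^ (m - n) * k)%:R :> R.
    by rewrite natrM natrX -{1}(subnK nm) exprD; field; rewrite expf_neq0// pnatr_eq0 -lt0n.
  by rewrite frac_nat B0 mulr0.
apply: eq_big_nat => m /andP[_ mn]; congr (_ * B _).
have -> : b%:R ^+ m * (k%:R / b%:R ^+ n) = k%:R / (b ^ (n - m))%:R :> R.
  rewrite natrX -{1}(subnK (ltnW mn)) exprD.
  by field; rewrite !expf_neq0// pnatr_eq0 -lt0n.
by rewrite frac_ratio// /node natrX.
Qed.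

Lemma bridge_succ_node r k :
  B (node b r (k.+1 %% b ^ r)) = B (node b r (k %% b ^ r).+1).
Proof.
have [e|lt] := eqVneq (k %% b ^ r).+1 (b ^ r)%N.
  have -> : (k.+1 %% b ^ r = 0)%N by rewrite -addn1 -modnDml addn1 e modnn.
  rewrite e /node mul0r B0 natrX divff ?B1// expf_neq0//.
  by rewrite pnatr_eq0 -lt0n.
congr (B (node b r _)); rewrite -addn1 -modnDml addn1 modn_small//.
by rewrite ltn_neqAle lt ltn_pmod.
Qed.

Lemma ww_bridge_increment n k :
  ww_bridge f kappa alpha b (k.+1%:R / b%:R ^+ n) -
  ww_bridge f kappa alpha b (k%:R / b%:R ^+ n) =
  alpha ^+ n * (wsum alpha b f n k - f 1 * wsum alpha b kappa n k).
Proof.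
rewrite !ww_bridge_badic -sumrB /wsum mulr_sumr -sumrB mulr_sumr.
rewrite big_add1/= big_nat_rev/=; apply: eq_big_nat => i /andP[_ ilt].
rewrite add0n bridge_succ_node -mulrBr.
have -> : (n - (n - i.+1) = i.+1)%N by rewrite subKn.
have -> : alpha ^+ (n - i.+1) = alpha ^+ n * alpha ^- i.+1.
  by rewrite -{2}(subnK ilt) exprD mulfK// expf_neq0// gt_eqF.
by rewrite /bridge /incr; ring.
Qed.

End fixed_path.

Hypothesis alpha2b : alpha ^+ 2 * b%:R = 1.

Lemma holder_wsum_bounded kappa tau : 1 / 2 < tau -> holder_on_01 kappa tau ->
  exists2 C, 0 <= C & forall n k, `|wsum alpha b kappa n k| <= C.
Proof.
move=> tau2 [C hC].
pose y := alpha `^ tau; pose z := y ^+ 2 / alpha.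
have z0 : 0 <= z by rewrite divr_ge0 ?sqr_ge0// ltW.
have z1 : z < 1.
  rewrite ltr_pdivrMr// mul1r -powR_mulrn ?powR_ge0// -powRrM.
  rewrite -[X in _ < X](powRr1 (ltW alpha_gt0)) /powR !gt_eqF// ltr_expR.
  rewrite -subr_gt0 -mulrBl nmulr_lgt0; first by lra.
  by rewrite ln_lt0.
have bE r : b%:R ^- r = (alpha ^+ r) ^+ 2 :> R.
  by rewrite (alpha_sqr_pow b_gt1 alpha2b) natrX.
have inc r k : `|incr b kappa r k| <= `|C| * (y ^+ r) ^+ 2.
  have node01 j : (j <= b ^ r)%N -> 0 <= (node b r j : R) <= 1.
    move=> jb; rewrite divr_ge0 ?exprn_ge0//= ler_pdivrMr ?exprn_gt0 ?ltr0n//.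
    by rewrite mul1r -natrX ler_nat.
  have lt := ltn_pmod k (bn_gt0 r).
  apply: le_trans (hC _ _ (node01 _ lt) (node01 _ (ltnW lt))) _.
  have -> : `|node b r (k %% b ^ r).+1 - node b r (k %% b ^ r)| = (alpha ^+ r) ^+ 2 :> R.
    rewrite /node -mulrBl -natr1 addrAC subrr add0r mul1r bE.
    by rewrite ger0_norm// exprn_even_ge0.
  have -> : ((alpha ^+ r) ^+ 2) `^ tau = (y ^+ r) ^+ 2.
    rewrite -!exprM -(powR_mulrn (r * 2) (ltW alpha_gt0)) -powRrM mulrC powRrM.
    exact: powR_mulrn (powR_ge0 _ _).
  by rewrite ler_wpM2r ?ler_norm// exprn_even_ge0.
exists (`|C| * (1 - z)^-1).
  by rewrite mulr_ge0// invr_ge0 subr_ge0 ltW.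
move=> n k; apply: le_trans (ler_norm_sum _ _ _) _.
apply: (@le_trans _ _ (\sum_(1 <= r < n.+1) `|C| * z ^+ r)).
  apply: ler_sum => r _; rewrite normrM ger0_norm; last by rewrite invr_ge0 exprn_ge0// ltW.
  apply: (@le_trans _ _ (alpha ^- r * (`|C| * (y ^+ r) ^+ 2))).
    by rewrite ler_wpM2l// invr_ge0 exprn_ge0// ltW.
  by rewrite mulrCA /z expr_div_n exprAC [alpha ^- r * _]mulrC.
by rewrite -mulr_sumr ler_wpM2l// sum_geometric_le.
Qed.

End bridge_increments.

(** * From the Gaussian sums to the variations *)

(** Polya's argument: monotonicity in [t] reduces the convergence to the
    countably many points [i / m]. *)
Lemma monotone_cvg_grid {R : realType} (q : nat -> R -> R) :
  (forall n s t, s <= t -> q n s <= q n t) ->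
  (forall m i, (i <= m.+1)%N -> q^~ (i%:R / m.+1%:R) @ \oo --> (i%:R / m.+1%:R : R)) ->
  forall t, 0 <= t <= 1 -> q^~ t @ \oo --> t.
Proof.
move=> mono grid t /andP[t0 t1]; apply/cvgrPdist_le => e e0.
have e2 : 0 < e / 2 by rewrite divr_gt0.
pose m := Num.truncn (e / 2)^-1.
have m0 : 0 < m.+1%:R :> R by rewrite ltr0n.
have me : m.+1%:R^-1 <= e / 2.
  rewrite -[leRHS]invrK lef_pV2 ?posrE ?invr_gt0//.
  by have /andP[_ /ltW] := truncn_itv (ltW (etrans (invr_gt0 _) e2)).
pose i := Num.truncn (t * m.+1%:R); pose j := minn i.+1 m.+1.
have tm0 : 0 <= t * m.+1%:R by rewrite mulr_ge0.
have /andP[i1 i2] := truncn_itv tm0.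
have im : (i <= m.+1)%N.
  by rewrite -(ler_nat R); apply: le_trans i1 _; rewrite ler_piMl.
have it : i%:R / m.+1%:R <= t by rewrite ler_pdivrMr.
have jt : t <= j%:R / m.+1%:R.
  rewrite ler_pdivlMr// /j natr_min le_min (ltW i2)/=.
  by rewrite ler_piMl.
have ji : j%:R / m.+1%:R <= i%:R / m.+1%:R + m.+1%:R^-1 :> R.
  by rewrite -[X in _ + X]mul1r -mulrDl ler_pM2r ?invr_gt0// natr1 ler_nat geq_minl.
have /cvgrPdist_le/(_ _ e2) ci := grid m i im.
have /cvgrPdist_le/(_ _ e2) cj := grid m j (geq_minr _ _).
near=> n.
have qi := mono n _ _ it; have qj := mono n _ _ jt.
have : `|i%:R / m.+1%:R - q n (i%:R / m.+1%:R)| <= e / 2 by near: n; exact: ci.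
have : `|j%:R / m.+1%:R - q n (j%:R / m.+1%:R)| <= e / 2 by near: n; exact: cj.
move: qi qj ji me it jt.
move: (m.+1%:R^-1) (i%:R / m.+1%:R) (j%:R / m.+1%:R) => z x y.
move: (q n x) (q n y) (q n t) => qx qy qt qxt qty yx ze xt ty.
rewrite !ler_norml => /andP[h1 h2] /andP[h3 h4]; apply/andP; split; lra.
Unshelve. all: end_near. Qed.

Lemma mean_square_perturbation {R : realType} (a e : nat -> nat -> R)
    (K : nat -> nat) (c : nat -> R) (C t : R) :
  0 <= C -> (forall n k, `|e n k| <= C) -> (forall n, c n ^+ 2 * (K n)%:R <= 1) ->
  (fun n => n%:R^-1 * \sum_(0 <= k < K n) (c n * a n k) ^+ 2) @ \oo --> t ->
  (fun n => n%:R^-1 * \sum_(0 <= k < K n) (c n * (a n k + e n k)) ^+ 2) @ \oo --> t.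
Proof.
move=> C0 eC cK; set u := fun n => _ => ut; set v := fun n => _.
pose eta n : R := Num.sqrt n%:R^-1.
have eta2 n : eta n ^+ 2 = n%:R^-1 by rewrite sqr_sqrtr// invr_ge0.
have eta0 : eta @ \oo --> (0 : R).
  rewrite -(@sqrtr0 R); apply: continuous_cvg; first exact: sqrt_continuous.
  exact: cvg_inv_nat.
pose del n := eta n * u n + C ^+ 2 * (eta n + eta n ^+ 2).
have del0 : del @ \oo --> (0 : R).
  rewrite -[X in _ --> X](_ : 0 * t + C ^+ 2 * (0 + 0 * 0) = 0); last by ring.
  apply: cvgD; first exact: cvgM.
  apply: cvgM; first exact: cvg_cst.
  apply: cvgD => //; under eq_fun do rewrite expr2; exact: cvgM.
have bound : \forall n \near \oo, `|v n - u n| <= del n.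
  near=> n; have n0 : 0 < n%:R :> R by rewrite ltr0n; near: n; exists 1%N.
  have h0 : 0 < eta n by rewrite sqrtr_gt0 invr_gt0.
  rewrite /v /u -mulrBr -sumrB normrM ger0_norm ?invr_ge0//.
  apply: (@le_trans _ _ (n%:R^-1 * (eta n * \sum_(0 <= k < K n) (c n * a n k) ^+ 2 +
      (c n ^+ 2 * (K n)%:R) * (C ^+ 2 / eta n + C ^+ 2)))).
    rewrite ler_pM2l ?invr_gt0//; apply: le_trans (ler_norm_sum _ _ _) _.
    rewrite [_ * (K n)%:R]mulrC -mulrA mulr_natl -[X in _ *+ X]subn0 -sumr_const_nat.
    rewrite mulr_sumr -big_split/=; apply: ler_sum => k _.
    have -> : (c n * (a n k + e n k)) ^+ 2 - (c n * a n k) ^+ 2 =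
        c n ^+ 2 * (2 * a n k * e n k + e n k ^+ 2) by ring.
    have -> : eta n * (c n * a n k) ^+ 2 + c n ^+ 2 * (C ^+ 2 / eta n + C ^+ 2) =
        c n ^+ 2 * (eta n * a n k ^+ 2 + C ^+ 2 / eta n + C ^+ 2) by ring.
    rewrite normrM ger0_norm ?sqr_ge0// ler_wpM2l ?sqr_ge0//.
    apply: le_trans (ler_normD _ _) _; apply: lerD; last first.
      by rewrite normrX ler_pXn2r ?nnegrE.
    rewrite !normrM ger0_norm//.
    apply: (@le_trans _ _ (2 * `|a n k| * C)); first by rewrite ler_wpM2l// mulr_ge0.
    rewrite -[a n k ^+ 2]ger0_norm ?sqr_ge0// normrX -subr_ge0.
    have -> : eta n * `|a n k| ^+ 2 + C ^+ 2 / eta n - 2 * `|a n k| * C =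
       eta n * (`|a n k| - C / eta n) ^+ 2 by field; rewrite gt_eqF.
    by rewrite mulr_ge0 ?sqr_ge0// ltW.
  rewrite /del /u mulrDr mulrCA; apply: lerD => //.
  apply: (@le_trans _ _ (n%:R^-1 * (C ^+ 2 / eta n + C ^+ 2))).
    rewrite ler_pM2l ?invr_gt0// ler_piMl// addr_ge0 ?sqr_ge0//.
    by rewrite divr_ge0 ?sqr_ge0// ltW.
  rewrite -eta2 le_eqVlt; apply/orP; left; apply/eqP; field.
  by rewrite gt_eqF.
apply: (@squeeze_cvgr _ _ _ _ (fun n => u n - del n) (fun n => u n + del n)).
- by near do rewrite -ler_distlC distrC.
- by rewrite -[X in _ --> X]subr0; apply: cvgB.
- by rewrite -[X in _ --> X]addr0; apply: cvgD.
Unshelve. all: end_near. Qed.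

Section pathwise.
Context {R : realType}.
Variables (x : nat -> nat -> R) (N : nat -> nat) (M rho : R).
Hypotheses (M0 : 0 <= M) (rho01 : 0 < rho < 1)
  (x_le : \forall n \near \oo, forall k, (k < N n)%N -> `|x n k| <= M * rho ^+ n)
  (qv : (fun n => n%:R^-1 * \sum_(0 <= k < N n) x n k ^+ 2) @ \oo --> (1 : R)).

Let rho_gt0 : 0 < rho. Proof. by case/andP: rho01. Qed.

Lemma cvg_scaled_geometric : (fun n => M * rho ^+ n) @ \oo --> (0 : R).
Proof.
rewrite -(mulr0 M); apply: cvgM; first exact: cvg_cst.
by apply: cvg_expr; rewrite ger0_norm ?(ltW rho_gt0)//; case/andP: rho01.
Qed.

Lemma sum_powR_cvgy (p : R) : 0 < p <= 2 ->
  ((fun n => (\sum_(0 <= k < N n) `|x n k| `^ p)%:E) @ \oo --> +oo)%E.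
Proof.
move=> /andP[p0 p2]; apply/cvgeryP/cvgryPge => A.
have M1 : \forall n \near \oo, M * rho ^+ n <= 1.
  have /cvgrPdist_le/(_ 1 ltr01) := cvg_scaled_geometric.
  by apply: filterS => n; rewrite sub0r normrN; exact: le_trans (ler_norm _).
have qv2 : \forall n \near \oo, 1 / 2 <= n%:R^-1 * \sum_(0 <= k < N n) x n k ^+ 2.
  have /cvgrPdist_le/(_ (1 / 2)) := qv; rewrite divr_gt0// => /(_ isT).
  by apply: filterS => n; rewrite ler_norml => /andP[_]; lra.
near=> n.
have n0 : 0 < n%:R :> R by rewrite ltr0n; near: n; exists 1%N.
apply: (@le_trans _ _ (\sum_(0 <= k < N n) x n k ^+ 2)).
  apply: (@le_trans _ _ (n%:R * (1 / 2))).
    rewrite mul1r ler_pdivlMr//.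
    apply: le_trans (real_ler_norm (num_real _)) _.
    near: n; exact: nbhs_infty_ger.
  by rewrite -ler_pdivlMl//; near: n; exact: qv2.
apply: ler_sum_nat => k /andP[_ kN].
have x1 : `|x n k| <= 1.
  apply: le_trans (_ : M * rho ^+ n <= 1); last by near: n; exact: M1.
  by move: k kN; near: n; exact: x_le.
have [->|x0] := eqVneq (x n k) 0; first by rewrite normr0 expr0n/= powR_ge0.
rewrite -real_normK ?num_real// -powR_mulrn//.
by apply: ger_powR => //; rewrite normr_gt0 x0.
Unshelve. all: end_near. Qed.

Lemma sum_powR_cvg0 (p : R) : 2 < p ->
  ((fun n => (\sum_(0 <= k < N n) `|x n k| `^ p)%:E) @ \oo --> 0)%E.
Proof.
move=> p2; have q0 : 0 < p - 2 by rewrite subr_gt0.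
have qn : p - 2 != 0 by rewrite gt_eqF.
apply: cvg_EFin; first exact: nearW.
pose sigma := rho `^ (p - 2).
have s0 : 0 < sigma by rewrite powR_gt0.
have s1 : sigma < 1.
  have /andP[_ r1] := rho01.
  by rewrite /sigma /powR gt_eqF// expR_lt1 pmulr_rlt0// ln_lt0// rho_gt0.
have [C C0 hC] : exists2 C : R, 0 <= C & forall n, n%:R ^+ 2 * sigma ^+ n <= C.
  by apply: poly_geometric_bounded; rewrite s0.
pose G := M `^ (p - 2) * (2 * C); have G0 : 0 <= G.
  by rewrite mulr_ge0 ?powR_ge0// mulr_ge0.
have qv2 : \forall n \near \oo, n%:R^-1 * \sum_(0 <= k < N n) x n k ^+ 2 <= 2.
  have /cvgrPdist_le/(_ 1 ltr01) := qv.
  by apply: filterS => n; rewrite ler_norml => /andP[+ _]; lra.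
apply: (@squeeze_cvgr _ _ _ _ (fun=> 0) (fun n => G * n%:R^-1)).
- near=> n.
  have n0 : 0 < n%:R :> R by rewrite ltr0n; near: n; exists 1%N.
  have S2 : \sum_(0 <= k < N n) x n k ^+ 2 <= n%:R * 2.
    by rewrite -ler_pdivrMl//; near: n; exact: qv2.
  apply/andP; split; first by apply: sumr_ge0 => k _; rewrite powR_ge0.
  apply: (@le_trans _ _ (\sum_(0 <= k < N n) (M * rho ^+ n) `^ (p - 2) * x n k ^+ 2)).
    apply: ler_sum_nat => k /andP[_ kN].
    have xk : `|x n k| <= M * rho ^+ n by move: k kN; near: n; exact: x_le.
    rewrite -[x n k ^+ 2]real_normK ?num_real//.
    have -> : `|x n k| `^ p = `|x n k| `^ (p - 2) * `|x n k| ^+ 2.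
      rewrite -powR_mulrn// -powRD ?subrK//.
      by apply/implyP => /eqP p00; exfalso; move: p2 p00; lra.
    rewrite ler_wpM2r ?sqr_ge0//.
    apply: ge0_ler_powR; rewrite ?nnegrE//; first exact: ltW.
    exact: le_trans xk.
  rewrite -mulr_sumr; apply: (@le_trans _ _ ((M * rho ^+ n) `^ (p - 2) * (n%:R * 2))).
    by rewrite ler_wpM2l// powR_ge0.
  rewrite powRM ?exprn_ge0 ?(ltW rho_gt0)//.
  have -> : (rho ^+ n) `^ (p - 2) = sigma ^+ n.
    rewrite -(powR_mulrn n (ltW rho_gt0)) -powRrM mulrC powRrM.
    exact: powR_mulrn (powR_ge0 _ _).
  rewrite /G -!mulrA ler_wpM2l ?powR_ge0//.
  rewrite mulrA [leLHS]mulrC ler_pM2l// ler_pdivlMr//.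
  by rewrite -mulrA -expr2 mulrC hC.
- exact: cvg_cst.
- rewrite -(mulr0 G); apply: cvgM; first exact: cvg_cst.
  exact: cvg_inv_nat.
Unshelve. all: end_near. Qed.

End pathwise.

Unset Implicit Arguments. Set Strict Implicit. Set Printing Implicit Defensive.

Theorem theorem2p4 (R : realType) (d : measure_display) (T : measurableType d)
  (P : probability T R) (W : R -> T -> R) (kappa : R -> R)
  (alpha : R) (b : nat) :
  standard_brownian_motion P W ->
  kappa 0 = 0 -> kappa 1 = 1 ->
  (forall t : R, 0 <= t <= 1 -> 0 <= kappa t <= 1) ->
  (exists tau : R, 1 / 2 < tau <= 1 /\ holder_on_01 kappa tau) ->
  0 < alpha < 1 -> (2 <= b)%N -> alpha ^+ 2 * b%:R = 1 ->
  {ae P, forall w : T,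
    (forall t : R, 0 < t <= 1 ->
       (fun n : nat => n%:R^-1 * badic_qv_sum (ww_bridge (W ^~ w) kappa alpha b) b t n)
         @ \oo --> t)
    /\ (forall p : R, 0 < p <= 2 ->
          pvariation_is (ww_bridge (W ^~ w) kappa alpha b) b p 1 +oo%E)
    /\ (forall p : R, 2 < p ->
          pvariation_is (ww_bridge (W ^~ w) kappa alpha b) b p 1 0%E)}.
Proof.
move=> BM k0 k1 _ [tau [/andP[tau2 _] hold]] alpha01 b2 alpha2b.
have /andP[alpha0 alpha1] := alpha01.
have [D D0 hD] := holder_wsum_bounded alpha01 b2 alpha2b tau2 hold.
pose S w n k := wsum alpha b (W^~ w) n k.
pose Q w n (t : R) := n%:R^-1 *
  \sum_(0 <= k < Num.truncn (t * b%:R ^+ n)) (alpha ^+ n * S w n k) ^+ 2.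
have grid : {ae P, forall w, forall m i, (i <= m.+1)%N ->
    (Q w)^~ (i%:R / m.+1%:R) @ \oo --> (i%:R / m.+1%:R : R)}.
  apply/ae_foralln => m; apply/ae_foralln => i.
  have [im|im] := leqP i m.+1; last by apply: aeW.
  have := @ae_mean_square_cvg _ _ _ _ _ _ _ BM alpha01 b2 alpha2b (i%:R / m.+1%:R).
  rewrite divr_ge0//= ler_pdivrMr ?ltr0n// mul1r ler_nat im => /(_ isT).
  by apply: filterS.
have four := ae_fourth_moment_cvg0 BM alpha01 b2 alpha2b.
have zero := brownian_motion_at0 BM.
apply: filterS3 grid four zero => w grid four W0.
set X := ww_bridge (W^~ w) kappa alpha b.
pose e n k := - (W 1 w * wsum alpha b kappa n k).
have eb n k : `|e n k| <= `|W 1 w| * D by rewrite normrN normrM ler_wpM2l.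
have XE n k : X (k.+1%:R / b%:R ^+ n) - X (k%:R / b%:R ^+ n) =
    alpha ^+ n * (S w n k + e n k).
  exact: ww_bridge_increment.
have qv t : 0 <= t <= 1 ->
    (fun n : nat => n%:R^-1 * badic_qv_sum X b t n) @ \oo --> t.
  move=> t01; rewrite /badic_qv_sum.
  under eq_fun do under eq_bigr do rewrite XE.
  apply: (@mean_square_perturbation _ (S w) e
    (fun n => Num.truncn (t * b%:R ^+ n)) (fun n => alpha ^+ n) (`|W 1 w| * D)) => //.
  - by rewrite mulr_ge0.
  - move=> n; rewrite (alpha_sqr_pow b2 alpha2b) mulrC ler_pdivrMr ?ltr0n ?expn_gt0 ?(ltnW b2)//.
    by rewrite mul1r ler_nat truncn_badic_le.
  - apply: (monotone_cvg_grid (q := Q w)) => // n s u su.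
    rewrite ler_wpM2l ?invr_ge0//.
    rewrite [leRHS](big_cat_nat (n := Num.truncn (s * b%:R ^+ n)))//=.
      by rewrite lerDl sumr_ge0// => k _; exact: sqr_ge0.
    by apply: le_truncn; rewrite ler_wpM2r// exprn_ge0.
pose rho := Num.sqrt (Num.sqrt alpha).
have rho0 : 0 < rho by rewrite !sqrtr_gt0.
have rho1 : rho < 1 by rewrite -sqrtr1 ltr_sqrt// -sqrtr1 ltr_sqrt.
have rho4 : rho ^+ 4 = alpha.
  by rewrite (exprM _ 2 2) !sqr_sqrtr// ?sqrtr_ge0// ltW.
have alpha_le_rho : alpha <= rho.
  by rewrite -rho4 exprS ler_piMr ?(ltW rho0)// exprn_ile1// ltW.
pose M := 1 + `|W 1 w| * D; have M0 : 0 <= M by rewrite addr_ge0// mulr_ge0.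
have N1 n : Num.truncn (1 * b%:R ^+ n : R) = (b ^ n)%N by rewrite mul1r -natrX natrK.
have small : \forall n \near \oo, forall k, (k < b ^ n)%N ->
    `|alpha ^+ n * (S w n k + e n k)| <= M * rho ^+ n.
  have /cvgrPdist_le/(_ 1 ltr01) := four; apply: filterS => n.
  rewrite sub0r normrN => /(le_trans (ler_norm _)).
  have an : 0 < alpha ^+ n by rewrite exprn_gt0.
  rewrite ler_pdivrMl// mulr1 => le4 k kb.
  have le4k : (alpha ^+ n * S w n k) ^+ 4 <= alpha ^+ n.
    apply: le_trans le4; rewrite (bigD1_seq k) ?iota_uniq ?mem_index_iota//=.
    by rewrite lerDl sumr_ge0// => i _; rewrite exprn_even_ge0.
  rewrite mulrDr; apply: le_trans (ler_normD _ _) _; rewrite /M mulrDl mul1r.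
  apply: lerD.
    rewrite -(@ler_pXn2r _ 4) ?nnegrE ?exprn_ge0// ?(ltW rho0)//.
    by rewrite exprAC rho4 -normrX ger0_norm// exprn_even_ge0.
  rewrite normrM (ger0_norm (ltW an)) [leLHS]mulrC; apply: ler_pM => //; first exact: ltW.
  by apply: lerXn2r; rewrite ?nnegrE ?(ltW alpha0) ?(ltW rho0).
have qv1 : (fun n => n%:R^-1 * \sum_(0 <= k < b ^ n)
    (alpha ^+ n * (S w n k + e n k)) ^+ 2) @ \oo --> (1 : R).
  have := qv 1; rewrite ler01 lexx => /(_ isT); rewrite /badic_qv_sum.
  by under eq_fun do under eq_bigr do rewrite XE; under eq_fun do rewrite N1.
have rho01 : 0 < rho < 1 by rewrite rho0.
split; first by move=> t /andP[/ltW t0 t1]; apply: qv; rewrite t0.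
have pvar p v : ((fun n => (\sum_(0 <= k < b ^ n)
    `|alpha ^+ n * (S w n k + e n k)| `^ p)%:E) @ \oo --> v)%E ->
    pvariation_is X b p 1 v.
  suff E : (fun n => (badic_pvar_sum X b p 1 n)%:E) = (fun n => (\sum_(0 <= k < b ^ n)
      `|alpha ^+ n * (S w n k + e n k)| `^ p)%:E) by rewrite /pvariation_is E.
  apply/funext => n; rewrite /badic_pvar_sum N1; congr EFin.
  by apply: eq_bigr => k _; rewrite XE.
split=> p hp; apply: pvar.
- exact: (sum_powR_cvgy rho01 small qv1 hp).
- exact: (sum_powR_cvg0 M0 rho01 small qv1 hp).
Qed.
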